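(* Let $R$ be a commutative Noetherian local ring of Krull dimension $3$ that is quasi-normal, and let $I$ be an unmixed (proper) ideal of $R$ of finite projective dimension. Then $D(I)\subseteq \overline{I}$, where $\overline{I}$ denotes the integral closure of $I$.
   Context: A ring is quasi-normal if it satisfies $(G_1)$ (i.e. $R_{\mathfrak p}$ is Gorenstein for every prime $\mathfrak p$ of height at most one) and Serre's condition $(S_2)$. An ideal $I$ is unmixed if every associated prime of $R/I$ has height equal to $\mathrm{ht}(I)$. For an ideal $I$ of grade $g=\mathrm{grade}(I,R)$, the higher divisorial ideal is $D(I):=\mathrm{Ann}_R(\mathrm{Ext}^g_R(R/I,R))$. *)

(* Defs.v *)
From HB Require Import structures.
From mathcomp Require Import all_boot all_order all_algebra.
From mathcomp Require Import generic_quotient ring_quotient.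
From mathcomp Require Import boolp classical_sets functions.
From mathcomp Require Import finmap ring.
From mathcomp.multinomials Require Import monalg.

Set Implicit Arguments.
Unset Strict Implicit.
Unset Printing Implicit Defensive.

Import Order.TTheory GRing.Theory.

Local Open Scope classical_set_scope.
Local Open Scope ring_scope.
Local Open Scope quotient_scope.

(* Ideals are MathComp's [idealr R] and [prime_idealr R]; both are proper by
   definition.  They are boolean predicates, which under the axioms of [boolp]
   are the same as arbitrary subsets of R. *)

Section Submodules.
Variables (R : comNzRingType) (V : lmodType R).

Definition mk_submod (S : {pred V}) (closedS : submod_closed S) :
    submodClosed V :=
  HB.pack (S : {pred V})
    (GRing.isSubmodClosed.Build R V S (GRing.submod_closed_semi closedS)).

Variable S : submodClosed V.

Definition submod : Type := {x : V | x \in S}.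
HB.instance Definition _ := SubType.on submod.
HB.instance Definition _ := Choice.on submod.
HB.instance Definition _ := [SubChoice_isSubLmodule of submod by <:].

(* MathComp quotients by a zmodClosed predicate, which submodClosed does not
   inherit from. *)
Fact submod_zmod_closed : zmod_closed S.
Proof.
by split=> [|x y Sx Sy]; rewrite ?rpred0 // -scaleN1r rpredD ?rpredZ.
Qed.
Definition submod_zmod : zmodClosed V :=
  HB.pack (S : {pred V})
    (GRing.isZmodClosed.Build V (S : {pred V}) submod_zmod_closed).

Definition quotmod : Type := Quotient.quot submod_zmod.
HB.instance Definition _ := EqQuotient.on quotmod.
HB.instance Definition _ := ZmodQuotient.on quotmod.
Let pi : V -> quotmod := \pi_(Quotient.quot submod_zmod).

Lemma quotmod_piP (x y : V) : (pi x = pi y) <-> (x - y \in S).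
Proof.
split=> [/eqP|xy]; first by rewrite -Quotient.idealrBE.
by apply/eqP; rewrite -Quotient.idealrBE.
Qed.

Definition quotmod_scale (a : R) (x : quotmod) : quotmod := pi (a *: repr x).

Lemma quotmod_scale_pi a x : quotmod_scale a (pi x) = pi (a *: x).
Proof.
apply/quotmod_piP; rewrite -scalerBr rpredZ //.
by apply/quotmod_piP; rewrite /pi reprK.
Qed.

Lemma quotmod_pi_surj (x : quotmod) : exists y, x = pi y.
Proof. by exists (repr x); rewrite /pi reprK. Qed.

Lemma quotmod_piD (x y : V) : pi (x + y) = pi x + pi y.
Proof. exact: (raddfD (\pi_(Quotient.quot submod_zmod))). Qed.

Fact quotmod_scalerA a b x :
  quotmod_scale a (quotmod_scale b x) = quotmod_scale (a * b) x.
Proof.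
by have [y ->] := quotmod_pi_surj x; rewrite !quotmod_scale_pi scalerA.
Qed.

Fact quotmod_scale1r : left_id 1 quotmod_scale.
Proof.
by move=> x; have [y ->] := quotmod_pi_surj x; rewrite quotmod_scale_pi scale1r.
Qed.

Fact quotmod_scalerDr : right_distributive quotmod_scale +%R.
Proof.
move=> a x y; have [x' ->] := quotmod_pi_surj x.
have [y' ->] := quotmod_pi_surj y.
by rewrite -quotmod_piD !quotmod_scale_pi scalerDr quotmod_piD.
Qed.

Fact quotmod_scalerDl x :
  {morph quotmod_scale^~ x : a b / a + b}.
Proof.
move=> a b /=; have [y ->] := quotmod_pi_surj x.
by rewrite !quotmod_scale_pi scalerDl quotmod_piD.
Qed.

HB.instance Definition _ := GRing.Zmodule_isLmodule.Build R quotmod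
  quotmod_scalerA quotmod_scale1r quotmod_scalerDr quotmod_scalerDl.

End Submodules.

Section KernelImage.
Variables (R : comNzRingType) (U V : lmodType R) (f : {linear U -> V}).

Fact ker_closed : submod_closed [pred x : U | f x == 0].
Proof.
split=> [|a x y]; rewrite !inE ?raddf0 // => /eqP fx /eqP fy.
by rewrite linearP fx fy scaler0 addr0.
Qed.
Definition ker : submodClosed U := mk_submod ker_closed.

Fact im_closed : submod_closed [pred y : V | `[< exists x, f x = y >]].
Proof.
split=> [|a y1 y2]; rewrite !inE.
  by apply/asboolP; exists 0; rewrite raddf0.
move=> /asboolP[x1 <-] /asboolP[x2 <-]; apply/asboolP.
by exists (a *: x1 + x2); rewrite linearP.
Qed.
Definition im : submodClosed V := mk_submod im_closed.

Fact preim_closed (S : submodClosed V) : submod_closed [pred x : U | f x \in S].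
Proof.
split=> [|a x y]; rewrite !inE ?raddf0 ?rpred0 // => fx fy.
by rewrite linearP rpredD // rpredZ.
Qed.
Definition preim_submod (S : submodClosed V) : submodClosed U :=
  mk_submod (preim_closed S).

End KernelImage.

Fact zero_closed (R : comNzRingType) (V : lmodType R) :
  submod_closed [pred x : V | x == 0].
Proof.
split=> [|a x y]; rewrite !inE // => /eqP-> /eqP->.
by rewrite scaler0 addr0.
Qed.
Definition zero_submod (R : comNzRingType) (V : lmodType R) : submodClosed V :=
  mk_submod (@zero_closed R V).

(* (Z + B) / B is taken as Z / (Z :&: B), so that Z / B is meaningful even
   before B is known to be contained in Z. *)
Definition subquot (R : comNzRingType) (V : lmodType R)
    (Z B : submodClosed V) : lmodType R :=
  quotmod (preim_submod (\val : {linear submod Z -> V}) B).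

Section Hom.
Variables (R : comNzRingType) (U V : lmodType R).

Fact hom_closed : submod_closed [pred f : U -> V | `[< linear f >]].
Proof.
split=> [|a f g]; rewrite !inE.
  by apply/asboolP=> a x y; rewrite /GRing.zero /= scaler0 addr0.
move=> /asboolP fl /asboolP gl; apply/asboolP=> b x y.
rewrite !fctE fl gl !scalerDr !scalerA (mulrC a b) -!addrA.
by congr (_ + _); rewrite addrCA.
Qed.
Definition hom : lmodType R := submod (mk_submod hom_closed).

Fact hom_linear (f : hom) : linear (\val f).
Proof. exact/asboolP/(valP f). Qed.

End Hom.

Section Precomposition.
Variables (R : comNzRingType) (U U' V : lmodType R) (f : {linear U -> U'}).

Fact precomp_subproof (g : hom U' V) :
  (\val g \o f) \in mk_submod (@hom_closed R U V).
Proof.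
by apply/asboolP=> a x y /=; rewrite linearP hom_linear.
Qed.
Definition precomp_fun (g : hom U' V) : hom U V :=
  exist _ (\val g \o f) (precomp_subproof g).

Fact precomp_is_linear : linear precomp_fun.
Proof. by move=> a g h; apply: val_inj. Qed.

Definition precomp : {linear hom U' V -> hom U V} :=
  HB.pack precomp_fun
    (GRing.isLinear.Build R _ _ _ precomp_fun precomp_is_linear).

End Precomposition.

(* {malg R[M]} is the free R-module on the underlying set of M. *)
Section Augmentation.
Variables (R : comNzRingType) (M : lmodType R).

Definition aug_fun (g : {malg R[M]}) : M := \sum_(m <- msupp g) g@_m *: m.

Fact aug_is_linear : linear aug_fun.
Proof.
have wide (D : {fset M}) g : (msupp g `<=` D)%fset ->
    aug_fun g = \sum_(m <- D) g@_m *: m.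
  move=> sD; apply: big_fset_incl => // m _ /mcoeff_outdom->.
  by rewrite scale0r.
move=> a g h; pose D := (msupp (a *: g + h) `|` msupp g `|` msupp h)%fset.
rewrite !(wide D) ?scaler_sumr -?big_split /=; first last.
- exact: fsubset_trans (fsubsetUl _ _) (fsubsetUl _ _).
- exact: fsubset_trans (fsubsetUr _ _) (fsubsetUl _ _).
- exact: fsubsetUr.
by apply: eq_bigr => m _; rewrite mcoeffD mcoeffZ scalerDl scalerA.
Qed.

Definition aug : {linear {malg R[M]} -> M} :=
  HB.pack aug_fun (GRing.isLinear.Build R _ _ _ aug_fun aug_is_linear).

End Augmentation.

Section Ext.
Variables (R : comNzRingType).

Fixpoint syzygy (M : lmodType R) (n : nat) : lmodType R :=
  if n is m.+1 then submod (ker (aug (syzygy M m))) else M.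

(* The functorial free resolution ... -> F_1 -> F_0 (-> M) of M, where
   F_0 = {malg R[M]} and F_(n.+1) is free on the kernel of F_n -> F_(n.-1). *)
Definition free_res (M : lmodType R) (n : nat) : lmodType R :=
  {malg R[syzygy M n]}.

Definition free_diff (M : lmodType R) (n : nat) :
    {linear free_res M n.+1 -> free_res M n} :=
  (\val : {linear submod (ker (aug (syzygy M n))) -> free_res M n})
    \o aug (syzygy M n.+1).

Definition codiff (M N : lmodType R) (n : nat) :
    {linear hom (free_res M n) N -> hom (free_res M n.+1) N} :=
  precomp N (free_diff M n).

Definition coboundary (M N : lmodType R) (n : nat) :
    submodClosed (hom (free_res M n) N) :=
  if n is m.+1 then im (codiff M N m) else zero_submod _.

Definition Ext (n : nat) (M N : lmodType R) : lmodType R :=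
  subquot (ker (codiff M N n)) (coboundary M N n).

End Ext.

Definition annihilator (R : comNzRingType) (M : lmodType R) : set R :=
  [set r | forall m : M, r *: m = 0].

Section HomologicalDimensions.
Variable (R : comNzRingType).

Definition projective (P : lmodType R) :=
  forall (U V : lmodType R) (g : {linear U -> V}) (f : {linear P -> V}),
    (forall v, exists u, g u = v) ->
    exists h : {linear P -> U}, forall x, g (h x) = f x.

Definition injective_module (E : lmodType R) :=
  forall (U V : lmodType R) (g : {linear U -> V}) (f : {linear U -> E}),
    injective g -> exists h : {linear V -> E}, forall x, h (g x) = f x.

Definition exact_at (U V W : lmodType R) (f : U -> V) (g : V -> W) :=
  forall v, g v = 0 <-> exists u, f u = v.

Definition finite_projdim (M : lmodType R) :=
  exists (n : nat) (P : nat -> lmodType R)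
    (d : forall i, {linear P i.+1 -> P i}) (e : {linear P 0%N -> M}),
    [/\ forall i, projective (P i),
        forall m, exists x, e x = m,
        exact_at (d 0%N) e,
        forall i, exact_at (d i.+1) (d i)
      & forall i, (n < i)%N -> forall x : P i, x = 0].

Definition finite_injdim (M : lmodType R) :=
  exists (n : nat) (E : nat -> lmodType R)
    (d : forall i, {linear E i -> E i.+1}) (e : {linear M -> E 0%N}),
    [/\ forall i, injective_module (E i),
        injective e,
        exact_at e (d 0%N),
        forall i, exact_at (d i) (d i.+1)
      & forall i, (n < i)%N -> forall x : E i, x = 0].

End HomologicalDimensions.

Section Ideals.
Variable (R : comNzRingType).

Fact ideal_submod_closed (I : idealr R) :
  @submod_closed R R^o (I : {pred R}).
Proof.
split=> [|a x y Ix Iy]; first exact: idealr0.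
by rewrite rpredD // [_ *: _]/(a * x) idealMr.
Qed.
Definition ideal_submod (I : idealr R) : submodClosed R^o :=
  mk_submod (@ideal_submod_closed I).

Definition gen_ideal (s : seq R) : set R :=
  [set a | exists c : nat -> R, a = \sum_(i < size s) c i * s`_i].

(* [idealr R] omits the unit ideal, which is always finitely generated. *)
Definition noetherian :=
  forall I : idealr R, exists s : seq R, forall a, (a \in I) <-> gen_ideal s a.

Definition maximal_ideal (m : idealr R) :=
  forall J : idealr R, {subset m <= J} -> J =i m.

Definition local_ring :=
  exists2 m : idealr R, maximal_ideal m &
    forall m' : idealr R, maximal_ideal m' -> m' =i m.

Definition prime_chain (n : nat) (P : nat -> prime_idealr R) :=
  forall i, (i < n)%N ->
    {subset P i <= P i.+1} /\ ~ {subset P i.+1 <= P i}.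

(* The suprema below live in nat, with [supremum] returning 0 on unbounded
   sets.  In a Noetherian ring heights of primes, and grades of proper ideals,
   are finite, as is the dimension of a Noetherian local ring. *)
Definition krull_dim : nat :=
  supremum 0%N [set n | exists P, prime_chain n P].

Definition height (p : prime_idealr R) : nat :=
  supremum 0%N [set n | exists2 P, prime_chain n P & P n =i p].

Definition ideal_height (I : idealr R) : nat :=
  infimum 0%N
    [set n | exists2 p : prime_idealr R, {subset I <= p} & height p = n].

Definition associated_prime (M : lmodType R) (p : prime_idealr R) :=
  exists m : M, forall a, (a \in p) = (a *: m == 0).

Definition unmixed (I : idealr R) :=
  forall p, associated_prime (quotmod (ideal_submod I)) p ->
    height p = ideal_height I.

Definition regular_seq (s : seq R) :=
  (forall i a, (i < size s)%N ->
     gen_ideal (take i s) (s`_i * a) -> gen_ideal (take i s) a)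
  /\ ~ gen_ideal s 1.

Definition grade (S : set R) : nat :=
  supremum 0%N [set size s | s in [set s | regular_seq s /\
                                           forall x, x \in s -> S x]].

(* Meant for local rings, where the set below is the maximal ideal. *)
Definition depth : nat :=
  grade [set x | exists2 m : idealr R, maximal_ideal m & x \in m].

Fixpoint ideal_pow (I : idealr R) (n : nat) : set R :=
  if n is m.+1 then
    [set a | exists (k : nat) (x y : nat -> R),
      (forall i, (i < k)%N -> x i \in I /\ ideal_pow I m (y i)) /\
      a = \sum_(i < k) x i * y i]
  else setT.

Definition integral_closure (I : idealr R) : set R :=
  [set r | exists (n : nat) (a : nat -> R),
    [/\ (0 < n)%N,
        forall i, (0 < i <= n)%N -> ideal_pow I i (a i)
      & r ^+ n + \sum_(1 <= i < n.+1) a i * r ^+ (n - i) = 0]].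

Definition divisorial (I : idealr R) : set R :=
  annihilator (Ext (grade [set` I]) (quotmod (ideal_submod I)) R^o).

End Ideals.

Section Localization.
Variables (R : comNzRingType) (p : prime_idealr R).

Definition loc_den : Type := {s : R | s \notin p}.
HB.instance Definition _ := SubType.on loc_den.
HB.instance Definition _ := Choice.on loc_den.

Definition preloc : Type := (R * loc_den)%type.
HB.instance Definition _ := Choice.on preloc.
Implicit Types x y z : preloc.

Definition loc_den_val (s : loc_den) : R := sval s.
Arguments loc_den_val : simpl never.
Let den x : R := loc_den_val x.2.

Fact loc_den1_subproof : 1 \notin p.
Proof. by rewrite idealr1. Qed.
Definition loc_den1 : loc_den := exist _ 1 loc_den1_subproof.

Fact loc_denM_subproof (s t : loc_den) : val s * val t \notin p.
Proof. by rewrite prime_idealrM negb_or (valP s) (valP t). Qed.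
Definition loc_denM (s t : loc_den) : loc_den :=
  exist _ (val s * val t) (loc_denM_subproof s t).

Definition loc_equiv : rel preloc := fun x y =>
  `[< exists u : loc_den, loc_den_val u * (x.1 * den y - y.1 * den x) = 0 >].

Fact loc_equivP x y : reflect
  (exists u : loc_den, loc_den_val u * (x.1 * den y - y.1 * den x) = 0)
  (loc_equiv x y).
Proof. exact: asboolP. Qed.

Let valM (s t : loc_den) :
  loc_den_val (loc_denM s t) = loc_den_val s * loc_den_val t.
Proof. by []. Qed.
Let val1 : loc_den_val loc_den1 = 1. Proof. by []. Qed.
Let denE := (valM, val1).

Fact loc_equiv_is_equiv : equiv_class_of loc_equiv.
Proof.
split=> [x|x y|y x z].
- by apply/loc_equivP; exists loc_den1; rewrite subrr mulr0.
- apply/loc_equivP/loc_equivP=> -[u hu]; exists u;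
  by rewrite -opprB mulrN hu oppr0.
- move=> /loc_equivP[u hu] /loc_equivP[v hv]; apply/loc_equivP.
  exists (loc_denM (loc_denM u v) y.2); rewrite !denE.
  transitivity (loc_den_val v * den z *
      (loc_den_val u * (x.1 * den y - y.1 * den x))
    + loc_den_val u * den x * (loc_den_val v * (y.1 * den z - z.1 * den y))).
    by rewrite /den /= ?denE /= /den /= ?denE; ring.
  by rewrite hu hv !mulr0 addr0.
Qed.

Canonical loc_equiv_rel := EquivRelPack loc_equiv_is_equiv.
Canonical loc_encModRel := defaultEncModRel loc_equiv.

Definition loc : Type := {eq_quot loc_equiv}.
HB.instance Definition _ := EqQuotient.on loc.
HB.instance Definition _ := Choice.on loc.

Definition preloc_add x y : preloc :=
  (x.1 * den y + y.1 * den x, loc_denM x.2 y.2).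
Definition preloc_opp x : preloc := (- x.1, x.2).
Definition preloc_mul x y : preloc := (x.1 * y.1, loc_denM x.2 y.2).

Definition loc0 : loc := \pi_loc (0, loc_den1).
Definition loc1 : loc := \pi_loc (1, loc_den1).
Definition loc_add (a b : loc) : loc := \pi_loc (preloc_add (repr a) (repr b)).
Definition loc_opp (a : loc) : loc := \pi_loc (preloc_opp (repr a)).
Definition loc_mul (a b : loc) : loc := \pi_loc (preloc_mul (repr a) (repr b)).

Lemma loc_piP x y : \pi_loc x = \pi_loc y <->
  exists u : loc_den, loc_den_val u * (x.1 * den y - y.1 * den x) = 0.
Proof.
split=> [/eqP|h]; first by rewrite eqmodE => /loc_equivP.
by apply/eqP; rewrite eqmodE; apply/loc_equivP.
Qed.

Lemma loc_reprP x : exists u : loc_den,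
  loc_den_val u *
    ((repr (\pi_loc x)).1 * den x - x.1 * den (repr (\pi_loc x))) = 0.
Proof. by apply/loc_piP; rewrite reprK. Qed.

Lemma loc_pi_add x y :
  loc_add (\pi_loc x) (\pi_loc y) = \pi_loc (preloc_add x y).
Proof.
rewrite /loc_add; have [u hu] := loc_reprP x; have [v hv] := loc_reprP y.
move: hu hv; set x' := repr _; set y' := repr _ => hu hv.
apply/loc_piP; exists (loc_denM u v); rewrite /den /= !denE.
transitivity (loc_den_val v * den y * den y' *
      (loc_den_val u * (x'.1 * den x - x.1 * den x'))
  + loc_den_val u * den x * den x' *
      (loc_den_val v * (y'.1 * den y - y.1 * den y'))).
  by rewrite /den /= ?denE /= /den /= ?denE; ring.
by rewrite hu hv !mulr0 addr0.
Qed.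

Lemma loc_pi_opp x : loc_opp (\pi_loc x) = \pi_loc (preloc_opp x).
Proof.
rewrite /loc_opp; have [u hu] := loc_reprP x.
by apply/loc_piP; exists u; rewrite /den /= !mulNr -opprD mulrN hu oppr0.
Qed.

Lemma loc_pi_mul x y :
  loc_mul (\pi_loc x) (\pi_loc y) = \pi_loc (preloc_mul x y).
Proof.
rewrite /loc_mul; have [u hu] := loc_reprP x; have [v hv] := loc_reprP y.
move: hu hv; set x' := repr _; set y' := repr _ => hu hv.
apply/loc_piP; exists (loc_denM u v); rewrite /den /= !denE.
transitivity (loc_den_val v * y'.1 * den y *
      (loc_den_val u * (x'.1 * den x - x.1 * den x'))
  + loc_den_val u * x.1 * den x' *
      (loc_den_val v * (y'.1 * den y - y.1 * den y'))).
  by rewrite /den /= ?denE /= /den /= ?denE; ring.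
by rewrite hu hv !mulr0 addr0.
Qed.

Lemma loc_pi_surj (a : loc) : exists x, a = \pi_loc x.
Proof. by exists (repr a); rewrite reprK. Qed.

Lemma loc_pi_eq x y : x.1 * den y = y.1 * den x -> \pi_loc x = \pi_loc y.
Proof. by move=> e; apply/loc_piP; exists loc_den1; rewrite e subrr mulr0. Qed.

Let pis := (loc_pi_add, loc_pi_opp, loc_pi_mul).

Fact loc_addA : associative loc_add.
Proof.
move=> a b c; have [x ->] := loc_pi_surj a; have [y ->] := loc_pi_surj b.
have [z ->] := loc_pi_surj c.
by rewrite !pis; apply: loc_pi_eq; rewrite /den /= ?denE /= /den /= ?denE; ring.
Qed.

Fact loc_addC : commutative loc_add.
Proof.
move=> a b; have [x ->] := loc_pi_surj a; have [y ->] := loc_pi_surj b.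
by rewrite !pis; apply: loc_pi_eq; rewrite /den /= ?denE /= /den /= ?denE; ring.
Qed.

Fact loc_add0 : left_id loc0 loc_add.
Proof.
move=> a; have [x ->] := loc_pi_surj a.
by rewrite !pis; apply: loc_pi_eq; rewrite /den /= ?denE /= /den /= ?denE; ring.
Qed.

Fact loc_addN : left_inverse loc0 loc_opp loc_add.
Proof.
move=> a; have [x ->] := loc_pi_surj a.
by rewrite !pis; apply: loc_pi_eq; rewrite /den /= ?denE /= /den /= ?denE; ring.
Qed.

Fact loc_mulA : associative loc_mul.
Proof.
move=> a b c; have [x ->] := loc_pi_surj a; have [y ->] := loc_pi_surj b.
have [z ->] := loc_pi_surj c.
by rewrite !pis; apply: loc_pi_eq; rewrite /den /= ?denE /= /den /= ?denE; ring.
Qed.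

Fact loc_mulC : commutative loc_mul.
Proof.
move=> a b; have [x ->] := loc_pi_surj a; have [y ->] := loc_pi_surj b.
by rewrite !pis; apply: loc_pi_eq; rewrite /den /= ?denE /= /den /= ?denE; ring.
Qed.

Fact loc_mul1 : left_id loc1 loc_mul.
Proof.
move=> a; have [x ->] := loc_pi_surj a.
by rewrite !pis; apply: loc_pi_eq; rewrite /den /= ?denE /= /den /= ?denE; ring.
Qed.

Fact loc_mulD : left_distributive loc_mul loc_add.
Proof.
move=> a b c; have [x ->] := loc_pi_surj a; have [y ->] := loc_pi_surj b.
have [z ->] := loc_pi_surj c.
by rewrite !pis; apply: loc_pi_eq; rewrite /den /= ?denE /= /den /= ?denE; ring.
Qed.

Fact loc_nontrivial : loc1 != loc0.
Proof.
apply/eqP=> /loc_piP[u]; rewrite /den /= ?denE !mulr1 subr0 mulr1 => u0.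
by have := svalP u; rewrite -[sval u]/(loc_den_val u) u0 idealr0.
Qed.

HB.instance Definition _ :=
  GRing.isZmodule.Build loc loc_addA loc_addC loc_add0 loc_addN.
HB.instance Definition _ :=
  GRing.Zmodule_isComNzRing.Build loc
    loc_mulA loc_mulC loc_mul1 loc_mulD loc_nontrivial.

End Localization.

(* The usual definition for a Noetherian local ring A; for other rings being
   Gorenstein is defined by localizing. *)
Definition gorenstein_local (A : comNzRingType) := finite_injdim A^o.

Definition G1 (R : comNzRingType) :=
  forall p : prime_idealr R, (height p <= 1)%N -> gorenstein_local (loc p).

Definition S2 (R : comNzRingType) :=
  forall p : prime_idealr R,
    (minn 2 (krull_dim (loc p)) <= depth (loc p))%N.

Definition quasi_normal (R : comNzRingType) := G1 R /\ S2 R.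

(* Main.v *)
From HB Require Import structures.
From mathcomp Require Import all_boot all_order all_algebra.
From mathcomp Require Import generic_quotient ring_quotient.
From mathcomp Require Import boolp classical_sets.
From mathcomp Require Import finmap ring.
From mathcomp.multinomials Require Import monalg.
Require Import Defs.

(** The stronger equality D(I) = I holds, and only D(I) <= I needs an argument.

    Let x be a maximal regular sequence in I, of length g = grade(I), and let q be
    an associated prime of R/I; it suffices to prove the inclusion locally at each
    such q.  Unmixedness, Serre's condition and dim R = 3 enter through one fact
    [unmixed_socle]: q is also associated to R/(x), in other words depth R_q = g.
    Indeed some associated prime of R/(x) contains I, so Serre's condition gives g >= min(2, ht I).  If
    ht I <= 2 then q, which has height ht I because I is unmixed, is minimal over
    (x); if ht I = 3 = dim R the only prime containing I is the maximal ideal.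

    Since (R/I)_q has depth 0 and finite projective dimension, the
    Auslander-Buchsbaum formula makes that dimension equal to depth R_q = g, so
    (R/I)_q is perfect of grade g.  For a perfect module, duality into R reverses
    the resolution, and Ext^g(R/I, R) has the same annihilator as R/I.

    This is carried out with explicit annihilators, without derived functors other
    than the given Ext and without localizing modules: statements at q are
    statements up to a multiplier s outside q.
    - [divisorial_colon]: D(I) lies in (x) : ((x) : I), because Hom(R/I, R/(x))
      embeds in Ext^g(R/I, R) by iterated connecting maps.
    - [tor_vanish], [tor_cycle]: on a finite free resolution of R/I, reduced
      modulo (x), the homology vanishes above degree g and contains a copy of R/I
      in degree g.
    - [splits_at_pred]: descending from the finite projective dimension, the
      boundary maps of degree above g split at q.  This is where q being the
      annihilator of some z in R/(x) is used.
    - [colon_colon_local]: hence R/I embeds at q in a free R/(x)-module.  The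
      coordinates of 1 lie in (x) : I, so whatever multiplies (x) : I into (x)
      lies in I at q. *)

Set Implicit Arguments.
Unset Strict Implicit.
Unset Printing Implicit Defensive.

Import GRing.Theory.
Local Open Scope classical_set_scope.
Local Open Scope ring_scope.

(** * Ideals as sets *)

Section IdealSets.
Variable R : comNzRingType.
Implicit Types (J K : set R) (a b r : R) (s : seq R).

(** Unlike [idealr R], this includes the unit ideal, so that it is stable under
    colons, sums and unions of chains. *)
Record ideal_set J : Prop := IdealSet {
  ideal_set0 : J 0;
  ideal_setD : forall a b, J a -> J b -> J (a + b);
  ideal_setM : forall r a, J a -> J (r * a) }.

Lemma ideal_setN J a : ideal_set J -> J a -> J (- a).
Proof. by move=> hJ Ja; rewrite -mulN1r; apply: ideal_setM. Qed.

Lemma ideal_setB J a b : ideal_set J -> J a -> J b -> J (a - b).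
Proof. by move=> hJ Ja Jb; apply: ideal_setD => //; apply: ideal_setN. Qed.

Lemma ideal_setMr J a r : ideal_set J -> J a -> J (a * r).
Proof. by move=> hJ Ja; rewrite mulrC; apply: ideal_setM. Qed.

Lemma ideal_set_sum J (T : Type) (l : seq T) (P : pred T) (F : T -> R) :
  ideal_set J -> (forall i, P i -> J (F i)) -> J (\sum_(i <- l | P i) F i).
Proof.
by move=> hJ hF; apply: big_ind => //; [apply: ideal_set0 | apply: ideal_setD].
Qed.

Lemma ideal_set_shift J a b : ideal_set J -> J (a - b) -> J b -> J a.
Proof. by move=> hJ Jab Jb; rewrite -(subrK b a); apply: ideal_setD. Qed.

Lemma ideal_set_idealr (I : idealr R) : ideal_set [set` I].
Proof.
split=> [|a b|r a] /=; first exact: idealr0; first exact: rpredD.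
exact: idealMr.
Qed.

Definition colon J a : set R := [set r | J (r * a)].

Lemma ideal_colon J a : ideal_set J -> ideal_set (colon J a).
Proof.
move=> hJ; split=> [|b c|r b]; rewrite /colon /=.
- by rewrite mul0r; apply: ideal_set0.
- by rewrite mulrDl; apply: ideal_setD.
- by rewrite -mulrA; apply: ideal_setM.
Qed.

Definition adjoin J a : set R := [set b | exists r, J (b - r * a)].

Lemma ideal_adjoin J a : ideal_set J -> ideal_set (adjoin J a).
Proof.
move=> hJ; split=> [|b c [r hr] [t ht]|r b [t ht]].
- by exists 0; rewrite mul0r subr0; apply: ideal_set0.
- exists (r + t); have -> : b + c - (r + t) * a = b - r * a + (c - t * a).
    by ring.
  exact: ideal_setD.
- exists (r * t); have -> : r * b - r * t * a = r * (b - t * a) by ring.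
  exact: ideal_setM.
Qed.

Lemma sub_adjoin J a : J `<=` adjoin J a.
Proof. by move=> b Jb; exists 0; rewrite mul0r subr0. Qed.

Lemma mem_adjoin J a : ideal_set J -> adjoin J a a.
Proof. by move=> hJ; exists 1; rewrite mul1r subrr; apply: ideal_set0. Qed.

Lemma ideal_gen_ideal s : ideal_set (gen_ideal s).
Proof.
split=> [|a b [c ->] [d ->]|r a [c ->]].
- by exists (fun=> 0); rewrite big1 // => i _; rewrite mul0r.
- exists (fun i => c i + d i); rewrite -big_split /=.
  by apply: eq_bigr => i _; rewrite mulrDl.
- exists (fun i => r * c i); rewrite mulr_sumr.
  by apply: eq_bigr => i _; rewrite mulrA.
Qed.

Lemma gen_ideal0 s : gen_ideal s 0.
Proof. exact: ideal_set0 (ideal_gen_ideal s). Qed.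

Lemma gen_ideal_min s J : ideal_set J -> (forall a, a \in s -> J a) ->
  gen_ideal s `<=` J.
Proof.
move=> hJ sJ _ [c ->]; apply: ideal_set_sum => // i _.
by apply: ideal_setM => //; apply/sJ/mem_nth.
Qed.

Lemma mem_gen_ideal s a : a \in s -> gen_ideal s a.
Proof.
move=> /(nthP 0)[i lt_i <-]; exists (fun j => (j == i)%:R).
rewrite (bigD1 (Ordinal lt_i)) //= eqxx mul1r big1 ?addr0 // => j.
by rewrite -val_eqE /= => /negPf->; rewrite mul0r.
Qed.

Lemma gen_ideal_nil a : gen_ideal [::] a -> a = 0.
Proof. by case=> c ->; rewrite big_ord0. Qed.

Lemma gen_ideal_rcons s b : gen_ideal (rcons s b) = adjoin (gen_ideal s) b.
Proof.
have hs := ideal_gen_ideal s; apply/seteqP; split=> a.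
  apply: gen_ideal_min; first exact: ideal_adjoin.
  move=> c; rewrite mem_rcons inE => /orP[/eqP->|sc]; first exact: mem_adjoin.
  by apply/sub_adjoin/mem_gen_ideal.
have hsb := ideal_gen_ideal (rcons s b).
case=> r hr; apply: (ideal_set_shift hsb (b := r * b)).
  apply: gen_ideal_min hr => // c sc; apply: mem_gen_ideal.
  by rewrite mem_rcons inE sc orbT.
by apply: ideal_setM => //; apply: mem_gen_ideal; rewrite mem_rcons mem_head.
Qed.

Lemma gen_ideal1 a b : gen_ideal [:: a] b <-> exists r, b = r * a.
Proof.
rewrite -[[:: a]]/(rcons [::] a) gen_ideal_rcons; split=> [[r]|[r ->]].
  by move=> /gen_ideal_nil/eqP; rewrite subr_eq0 => /eqP->; exists r.
by exists r; rewrite subrr; apply: gen_ideal0.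
Qed.

Lemma gen_ideal_takeS s k : (k < size s)%N ->
  gen_ideal (take k.+1 s) = adjoin (gen_ideal (take k s)) s`_k.
Proof. by move=> lt_k; rewrite (take_nth 0) // gen_ideal_rcons. Qed.

Lemma ideal_set_closed J : ideal_set J -> ~ J 1 ->
  idealr_closed [pred a : R | `[< J a >]].
Proof.
move=> hJ J1; split=> [||a b c]; rewrite !inE.
- by apply/asboolP; apply: ideal_set0.
- exact/asboolPn.
- move=> /asboolP Jb /asboolP Jc; apply/asboolP.
  by apply: ideal_setD => //; apply: ideal_setM.
Qed.

Lemma ideal_setP J : ideal_set J -> ~ J 1 ->
  exists I : idealr R, forall a, (a \in I) <-> J a.
Proof.
move=> hJ J1; pose S : {pred R} := [pred a | `[< J a >]].
pose I : idealr R := HB.pack S (isIdealr.Build R S (ideal_set_closed hJ J1)).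
by exists I => a; split=> /asboolP.
Qed.

Lemma prime_setP J : ideal_set J -> ~ J 1 ->
    (forall a b, J (a * b) -> J a \/ J b) ->
  exists P : prime_idealr R, forall a, (a \in P) <-> J a.
Proof.
move=> hJ J1 Jpr; pose S : {pred R} := [pred a | `[< J a >]].
have pS : prime_idealr_closed S.
  move=> a b; rewrite !inE => /asboolP /Jpr[/asboolP->|/asboolP->] //.
  by rewrite orbT.
pose P : prime_idealr R := HB.pack S
  (isIdealr.Build R S (ideal_set_closed hJ J1)) (isPrimeIdealrClosed.Build R S pS).
by exists P => a; split=> /asboolP.
Qed.

End IdealSets.

(** * Noetherian rings and associated primes *)

Section Noetherian.
Variable R : comNzRingType.
Hypothesis noethR : noetherian R.
Implicit Types (J K : set R) (a b r z : R) (s : seq R).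

Lemma ideal_set_fg J : ideal_set J -> exists s, J = gen_ideal s.
Proof.
move=> hJ; have [J1|nJ1] := pselect (J 1).
  exists [:: 1]; apply/seteqP; split=> a _.
    rewrite -[a]mulr1; apply: ideal_setM; first exact: ideal_gen_ideal.
    exact/mem_gen_ideal/mem_head.
  by rewrite -[a]mulr1; apply: ideal_setM.
have [I hI] := ideal_setP hJ nJ1; have [s hs] := noethR I.
exists s; apply/seteqP; split=> a; first by move/hI/hs.
by move/hs/hI.
Qed.

(** Otherwise there is a strictly increasing sequence in the family; finitely many
    generators of its union already lie in one member, which is then the union. *)
Lemma ideal_set_acc (F : set (set R)) J0 : (forall J, F J -> ideal_set J) ->
    F J0 ->
  exists J, [/\ F J, J0 `<=` J & forall K, F K -> J `<=` K -> K `<=` J].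
Proof.
move=> Fid FJ0; apply: contrapT => noJ.
have next (x : {J | F J /\ J0 `<=` J}) :
    {y : {J | F J /\ J0 `<=` J} | sval x `<=` sval y /\ ~ sval y `<=` sval x}.
  apply: cid; case: x => J [FJ J0J] /=; apply: contrapT => noK.
  apply: noJ; exists J; split=> // K FK JK; apply: contrapT => nKJ; apply: noK.
  have hK : F K /\ J0 `<=` K by split=> //; apply: subset_trans JK.
  by exists (exist _ K hK).
pose x := fix x n : {J | F J /\ J0 `<=` J} :=
  if n is m.+1 then sval (next (x m))
  else exist _ J0 (conj FJ0 (@subset_refl _ _)).
have xS n : sval (x n) `<=` sval (x n.+1) by case: (svalP (next (x n))).
have xmono m n : (m <= n)%N -> sval (x m) `<=` sval (x n).
  elim: n => [|n IHn]; first by rewrite leqn0 => /eqP->.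
  rewrite leq_eqVlt => /orP[/eqP->//|]; rewrite ltnS => /IHn h.
  exact: subset_trans h (xS n).
have xid n : ideal_set (sval (x n)) by apply: Fid; case: (svalP (x n)).
pose U := [set a | exists n, sval (x n) a].
have hU : ideal_set U.
  split=> [|a b [m ha] [n hb]|r a [m ha]].
  - by exists 0%N; apply: ideal_set0.
  - exists (maxn m n); apply: ideal_setD => //.
      by apply: xmono ha; apply: leq_maxl.
    by apply: xmono hb; apply: leq_maxr.
  - by exists m; apply: ideal_setM.
have [s Us] := ideal_set_fg hU.
have [N hN] : exists N, forall a, a \in s -> sval (x N) a.
  have : forall a, a \in s -> U a by move=> a sa; rewrite Us; apply: mem_gen_ideal.
  elim: {Us} s => [|b s IHs] sU; first by exists 0%N.
  have [|N hN] := IHs; first by move=> a sa; apply: sU; rewrite inE sa orbT.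
  have [M hM] := sU b (mem_head _ _); exists (maxn M N) => a.
  rewrite inE => /orP[/eqP->|/hN]; first exact: xmono (leq_maxl _ _) _ hM.
  exact/xmono/leq_maxr.
have [_] := svalP (next (x N)); apply=> a ha.
have : U a by exists N.+1.
by rewrite Us; apply: gen_ideal_min.
Qed.

(** An ideal maximal among those containing [J] and missing the
    multiplicative set [T] is prime. *)
Lemma prime_avoiding J (T : set R) : ideal_set J -> T 1 ->
    (forall a b, T a -> T b -> T (a * b)) -> (forall a, T a -> ~ J a) ->
  exists P : prime_idealr R,
    (forall a, J a -> a \in P) /\ (forall a, T a -> a \notin P).
Proof.
move=> hJ T1 TM TJ.
have [P [[hP TP] JP maxP]] := @ideal_set_acc
  [set K | ideal_set K /\ forall a, T a -> ~ K a] J (fun _ h => h.1) (conj hJ TJ).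
(* Any ideal properly containing [P] meets [T], by maximality. *)
have meets a : ~ P a -> exists r, exists2 t, T t & P (t - r * a).
  move=> nPa; apply: contrapT => noT; apply: nPa.
  have hPa := ideal_adjoin a hP.
  apply: (maxP (adjoin P a)); [split=> // t Tt [r hr] | exact: sub_adjoin
    | exact: mem_adjoin].
  by apply: noT; exists r, t.
have [|a b Pab|Q hQ] := @prime_setP R P hP.
- exact: TP.
- apply: contrapT => /not_orP[/meets[r [t Tt hr]] /meets[r' [t' Tt' hr']]].
  apply: (TP (t * t')); first exact: TM.
  have -> : t * t' = t' * (t - r * a) + r * a * (t' - r' * b)
    + r * r' * (a * b) by ring.
  apply: ideal_setD => //; last exact: ideal_setM.
  by apply: ideal_setD => //; apply: ideal_setM.
exists Q; split=> a; first by move/JP/hQ.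
by move=> /TP nPa; apply/negP=> /hQ.
Qed.

(** An annihilator in R/J, maximal among those of a family of nonzero elements
    stable under multiplication, is prime: if [b * c] kills [w] but [c] does
    not, then [b] kills [c * w], which has the same annihilator as [w]. *)
Lemma max_colon_prime J (W : set R) z : ideal_set J -> (forall w, W w -> ~ J w) ->
    (forall b w, W w -> ~ J (b * w) -> W (b * w)) -> W z ->
  exists P : prime_idealr R, exists w, [/\ W w, colon J z `<=` colon J w,
    forall a, (a \in P) <-> J (a * w)
    & forall v, W v -> colon J w `<=` colon J v -> colon J v `<=` colon J w].
Proof.
move=> hJ WJ Wmul Wz.
have [||_ [[w Ww ->] zw maxw]] := @ideal_set_acc
  [set K | exists2 w, W w & K = colon J w] (colon J z).
- by move=> _ [w _ ->]; apply: ideal_colon.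
- by exists z.
have maxW v : W v -> colon J w `<=` colon J v -> colon J v `<=` colon J w.
  by move=> Wv; apply: maxw; exists v.
have [|b c Jbcw|P hP] := prime_setP (ideal_colon w hJ).
- by rewrite /colon /= mul1r; apply: WJ.
- apply: contrapT => /not_orP[nJb nJc]; apply: nJb.
  apply: (maxW (c * w)); first exact: Wmul.
    move=> a Jaw; rewrite /colon /= mulrCA; exact: ideal_setM.
  by rewrite /colon /= mulrA.
by exists P, w.
Qed.

Lemma ass_prime_above J z : ideal_set J -> ~ J z ->
  exists P : prime_idealr R, exists b, forall a, (a \in P) <-> J (a * (b * z)).
Proof.
move=> hJ nJz.
have [||P [_ [[_ [b ->]] _ hP _]]] := @max_colon_prime J
    [set w | ~ J w /\ exists b, w = b * z] z hJ (fun _ h => h.1).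
- by move=> b w [_ [c ->]] nJ; split=> //; exists (b * c); rewrite mulrA.
- by split=> //; exists 1; rewrite mul1r.
by exists P, b.
Qed.

(** If [q] is minimal over [J], each of its elements has a power killed modulo
    [J] by an element outside [q], since otherwise a prime inside [q] would omit
    it.  Then [colon J z], chosen maximal among those
    inside [q], is all of [q]: multiplying [z] by elements outside [q] does not
    change it. *)
Lemma minimal_prime_ass J (q : prime_idealr R) : ideal_set J ->
    (forall a, J a -> a \in q) ->
    (forall P : prime_idealr R, (forall a, J a -> a \in P) ->
      {subset P <= q} -> {subset q <= P}) ->
  exists z, forall a, (a \in q) <-> J (a * z).
Proof.
move=> hJ Jq minq.
have nilp a : a \in q -> exists (s : R) n, s \notin q /\ J (s * a ^+ n).
  move=> qa; apply: contrapT => noT.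
  pose T := [set t | exists (s : R) n, s \notin q /\ t = s * a ^+ n].
  have [||t [s [n [qs ->]]] Jt|P [JP TP]] := @prime_avoiding J T hJ.
  - by exists 1, 0%N; rewrite idealr1 mulr1.
  - move=> _ _ [s [m [qs ->]]] [t [n [qt ->]]]; exists (s * t), (m + n)%N.
    by rewrite prime_idealrM (negPf qs) (negPf qt) exprD; split=> //; ring.
  - by apply: noT; exists s, n.
  have Pq : {subset P <= q}.
    move=> b Pb; apply: contraT => qb; have /TP : T b; last by rewrite Pb.
    by exists b, 0%N; rewrite mulr1.
  have /TP/negP[] : T a by exists 1, 1%N; rewrite idealr1 mul1r expr1.
  exact: minq.
have [||_ [[z zq ->] _ maxz]] := @ideal_set_acc
  [set K | exists2 z, colon J z `<=` [set` q] & K = colon J z] (colon J 1).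
- by move=> _ [w _ ->]; apply: ideal_colon.
- by exists 1 => // a; rewrite /colon /= mulr1; apply: Jq.
have stable (s : R) : colon J (s * z) `<=` [set` q] ->
    colon J (s * z) `<=` colon J z.
  move=> szq; apply: maxz; first by exists (s * z).
  by move=> a Ja; rewrite /colon /= mulrCA; apply: ideal_setM.
exists z => a; split; last exact: zq.
move=> qa; have [s [n [qs Jsan]]] := nilp a qa.
have sz_q b t : t \notin q -> colon J (b * z) `<=` [set` q] ->
    colon J (t * (b * z)) `<=` [set` q].
  move=> qt bzq c; rewrite /colon /= mulrA => /bzq /=.
  by rewrite prime_idealrM (negPf qt) orbF.
(* At the least [n] with the annihilator of [a ^+ n * z] not inside [q], some
   [t] outside [q] gives that [t * a] kills [a ^+ n.-1 * z], hence [z]. *)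
have {nilp}: ~ colon J (a ^+ n * z) `<=` [set` q].
  move=> /(_ s); rewrite /colon /= mulrA => h; case/negP: qs; apply: h.
  exact: ideal_setMr.
elim: n {Jsan} => [|n IHn] han; first by case: han; rewrite expr0 mul1r.
have [hn|/IHn//] := pselect (colon J (a ^+ n * z) `<=` [set` q]).
have [t [Jt /negP qt]] : exists t, J (t * (a ^+ n.+1 * z)) /\ ~ t \in q.
  apply: contrapT => no; apply: han => t Jt /=.
  by apply: contrapT => nqt; apply: no; exists t.
have : colon J (a ^+ n * z) (t * a).
  by rewrite /colon /=; move: Jt; congr (J _); rewrite exprS; ring.
move=> /(stable _ hn) Jtaz.
rewrite -[J _]/(colon J z a); apply: (stable t).
  by have := sz_q 1 t qt; rewrite mul1r; apply.
by move: Jtaz; rewrite /colon /= -mulrA mulrCA.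
Qed.

End Noetherian.

Section AssociatedPrimes.
Variable R : comNzRingType.
Hypothesis noethR : noetherian R.
Implicit Types (J K : set R) (a b r z : R) (s : seq R).

(** Maximality alone makes the annihilator prime; primality is recorded because
    every use of maximality needs it. *)
Let maxass J z := [/\ ~ J z, (forall a b, J (a * b * z) -> J (a * z) \/ J (b * z))
  & forall w, ~ J w -> colon J z `<=` colon J w -> colon J w `<=` colon J z].

(** One element outside the prime annihilator of [z] kills all of [s], as soon as
    each member of [s] is killed by some such element: take the product. *)
Lemma avoid_prod J z s : ideal_set J -> maxass J z ->
    (forall y, y \in s -> exists t, J (t * y) /\ ~ J (t * z)) ->
  exists t, (forall y, y \in s -> J (t * y)) /\ ~ J (t * z).
Proof.
move=> hJ [nJz zpr _]; elim: s => [_|y s IHs hs].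
  by exists 1; split=> //; rewrite mul1r.
have [w hw|t [ts tz]] := IHs; first by apply: hs; rewrite inE hw orbT.
have [u [uy uz]] := hs y (mem_head _ _); exists (u * t); split=> [w|/zpr[]//].
rewrite inE => /orP[/eqP->|/ts]; first by rewrite mulrAC; apply: ideal_setMr.
by rewrite -mulrA => ?; apply: ideal_setM.
Qed.

(** The maximal annihilators form an antichain, so in the inductive step of prime
    avoidance an element annihilating the new [z] and none of the old ones rules
    out any inclusion of the old annihilators in the new one. *)
Lemma avoid_maxass J (I : set R) s : ideal_set J -> ideal_set I ->
    (forall z, z \in s -> maxass J z) ->
    (forall z, z \in s -> ~ I `<=` colon J z) ->
  exists2 b, I b & forall z, z \in s -> ~ J (b * z).
Proof.
move=> hJ hI; elim: s => [_ _|z s IHs sM sI].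
  by exists 0 => //; apply: ideal_set0.
have [y hy|y hy|b Ib bs] := IHs; do ?by [apply: sM; rewrite inE hy orbT
  | apply: sI; rewrite inE hy orbT].
have zM := sM z (mem_head _ _); have [nJz zpr _] := zM.
have [Jbz|] := pselect (J (b * z)); last first.
  move=> nJbz; exists b => // y; rewrite inE => /orP[/eqP->//|]; exact: bs.
have [e [Ie ez]] : exists e, I e /\ ~ J (e * z).
  apply: contrapT => no; apply: (sI z (mem_head _ _)) => e Ie.
  by apply: contrapT => nJ; apply: no; exists e.
have [y sy|t [ts tz]] := @avoid_prod J z s hJ zM.
  apply: contrapT => no; have [_ _ ymax] := sM y (mem_behead (s := z :: s) sy).
  apply: (bs y sy); apply: (ymax z nJz _ b Jbz) => t Jty.
  by apply: contrapT => nJ; apply: no; exists t.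
exists (b + e * t) => [|y].
  by apply: ideal_setD => //; apply: ideal_setMr.
rewrite inE mulrDl => /orP[/eqP-> Jz|sy Jy].
  have /zpr[]// : J (e * t * z) by rewrite -(addKr (b * z) (e * t * z)) addrC;
    apply: ideal_setB.
apply: (bs y sy); rewrite -(addrK (e * t * y) (b * y)).
by apply: ideal_setB => //; rewrite -mulrA; apply: ideal_setM => //; apply: ts.
Qed.

(** Elements with maximal annihilator generate an ideal that finitely many of them
    already generate, say those of [s].  An element outside the annihilator of a
    further such [z] cannot kill all of [s], so the annihilator of some member of
    [s] lies in that of [z] and equals it by maximality.  Thus finitely many primes
    cover the zero divisors modulo [J], and prime avoidance applies. *)
Lemma zero_divisors_ass J (I : set R) : ideal_set J -> ~ J 1 -> ideal_set I ->
    (forall a, I a -> exists2 w, ~ J w & J (a * w)) ->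
  exists P : prime_idealr R, exists z,
    (forall a, (a \in P) <-> J (a * z)) /\ (forall a, I a -> a \in P).
Proof.
move=> hJ nJ1 hI Izd.
have primeof z : maxass J z -> exists P : prime_idealr R,
    forall a, (a \in P) <-> J (a * z).
  move=> [nJz zpr _].
  by apply: (prime_setP (ideal_colon z hJ)) => //; rewrite /colon /= mul1r.
have [||_ [[s sM ->] _ maxs]] := @ideal_set_acc R noethR
  [set K | exists2 s, (forall z, z \in s -> maxass J z) & K = gen_ideal s]
  (gen_ideal [::]).
- by move=> _ [s _ ->]; apply: ideal_gen_ideal.
- by exists [::].
have s_all z : maxass J z -> gen_ideal s z.
  move=> zM; apply: (maxs (gen_ideal (rcons s z))); last first.
  - by apply: mem_gen_ideal; rewrite mem_rcons mem_head.
  - by rewrite gen_ideal_rcons; apply: sub_adjoin.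
  exists (rcons s z) => // y; rewrite mem_rcons inE => /orP[/eqP->//|]; exact: sM.
have s_ann a w : ~ J w -> J (a * w) -> exists2 z, z \in s & J (a * z).
  move=> nJw Jaw.
  have [//|//|P [z [nJz wz hP maxz]]] := @max_colon_prime R noethR J
    [set v | ~ J v] w hJ (fun _ h => h).
  have zM : maxass J z.
    split=> // b c; rewrite -!hP prime_idealrM => /orP[]; [by left | by right].
  apply: contrapT => no.
  have [y sy|t [ts]] := @avoid_prod J z s hJ zM; last first.
    apply; rewrite mulrC; apply: (gen_ideal_min (ideal_colon t hJ) _ (s_all z zM)).
    by move=> y /ts; rewrite /colon /= mulrC.
  apply: contrapT => not; have [nJy _ ymax] := sM y sy; apply: no; exists y => //.
  apply: (ymax z nJz); last exact: wz.
  by move=> t Jty; apply: contrapT => nJ; apply: not; exists t.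
have [z sz Iz] : exists2 z, z \in s & I `<=` colon J z.
  apply: contrapT => no.
  have [|b Ib bs] := @avoid_maxass J I s hJ hI sM.
    by move=> z sz Iz; apply: no; exists z.
  by have [w nJw Jbw] := Izd b Ib; have [z sz] := s_ann b w nJw Jbw; apply: bs.
by have [P hP] := primeof z (sM z sz); exists P, z; split=> // a /Iz /hP.
Qed.

End AssociatedPrimes.

(** * Heights and grades as maxima *)

Section NatSuprema.
Implicit Types (A : set nat) (b n : nat).

(** The supremum of an unbounded set of naturals is 0 here, so the maximum
    property needs an explicit bound. *)
Lemma supremum_nat_max A b n : (forall m, A m -> (m <= b)%N) -> A n ->
  A (supremum 0%N A) /\ forall m, A m -> (m <= supremum 0%N A)%N.
Proof.
move=> Ab An.
have exA : exists m, `[< A m >] by exists n; apply/asboolP.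
have ubA m : `[< A m >] -> (m <= b)%N by move/asboolP/Ab.
case: (ex_maxnP exA ubA) => m /asboolP Am mmax.
suff -> : supremum 0%N A = m by split=> // k Ak; apply: mmax; apply/asboolP.
rewrite /supremum ifF; last by apply/negP=> /eqP A0; rewrite A0 in An.
apply: xget_subset1; last exact: is_subset1_supremums.
split=> [k Ak|k]; last by apply.
by rewrite leEnat; apply: mmax; apply/asboolP.
Qed.

Lemma supremum_nat_le A b : (forall m, A m -> (m <= b)%N) ->
  (supremum 0%N A <= b)%N.
Proof.
move=> Ab; have [->|/set0P[n An]] := eqVneq A set0; first by rewrite supremum0.
by have [/Ab] := supremum_nat_max Ab An.
Qed.

Lemma supremum_nat_bound A n : supremum 0%N A = n.+1 ->
  forall m, A m -> (m <= n.+1)%N.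
Proof.
rewrite /supremum; case: ifP => // _; case: xgetP => // k _ [ubA _] <- m.
exact: ubA.
Qed.

Lemma infimum_nat_le A n : A n -> (infimum 0%N A <= n)%N.
Proof.
move=> An; rewrite /infimum; case: ifP => // _.
by case: xgetP => // k _ [lbA _]; apply: lbA.
Qed.

End NatSuprema.

Section Heights.
Variable R : comNzRingType.
Implicit Types (P Q : prime_idealr R) (C : nat -> prime_idealr R).

Lemma prime_chain_rcons n C Q P : prime_chain n C -> C n =i Q ->
    {subset Q <= P} -> ~ {subset P <= Q} ->
  exists C', prime_chain n.+1 C' /\ C' n.+1 =i P.
Proof.
move=> hC CQ QP nPQ; exists (fun i => if (i <= n)%N then C i else P).
split; last by rewrite ltnn.
move=> i /=; rewrite ltnS => le_in; rewrite le_in.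
move: le_in; rewrite leq_eqVlt => /orP[/eqP->|lt_i].
  rewrite ltnn; split=> [a|PC]; first by rewrite CQ; apply: QP.
  by apply: nPQ => a /PC; rewrite CQ.
by rewrite lt_i; apply: hC.
Qed.

Lemma prime_chain_sub n C i : prime_chain n C -> (i <= n)%N ->
  {subset C i <= C n}.
Proof.
elim: n => [|n IHn] hC; first by rewrite leqn0 => /eqP->.
rewrite leq_eqVlt => /orP[/eqP->//|]; rewrite ltnS => le_in a Ca.
have [h _] := hC n (ltnSn n); apply: h; apply: IHn Ca => // j lt_j.
by apply: hC; apply: ltnW.
Qed.

Variable d : nat.
Hypothesis dimR : forall n C, prime_chain n C -> (n <= d)%N.

Lemma height_chain P : exists2 C, prime_chain (height P) C & C (height P) =i P.
Proof.
have [] := @supremum_nat_max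
  [set n | exists2 C, prime_chain n C & C n =i P] d 0%N => //.
- by move=> n [C /dimR].
- by exists (fun=> P).
Qed.

Lemma height_ge P n C : prime_chain n C -> C n =i P -> (n <= height P)%N.
Proof.
move=> hC CP; have [] := @supremum_nat_max
  [set m | exists2 C, prime_chain m C & C m =i P] d n.
- by move=> m [D /dimR].
- by exists C.
- by move=> _; apply; exists C.
Qed.

Lemma ideal_height_le (I : idealr R) P : {subset I <= P} ->
  (ideal_height I <= height P)%N.
Proof. by move=> IP; apply: infimum_nat_le; exists P. Qed.

Hypothesis noethR : noetherian R.

Lemma ex_maximal_above (I : idealr R) :
  exists P : prime_idealr R, {subset I <= P}.
Proof.
have [||a ->|P [IP _]] :=
  prime_avoiding noethR (T := [set 1]) (ideal_set_idealr I).
- by [].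
- by move=> a b -> ->; rewrite mulr1.
- by rewrite /= idealr1.
by exists P.
Qed.

Lemma height_top_maximal P : (d <= height P)%N -> maximal_ideal P.
Proof.
move=> le_dP J PJ a; apply/idP/idP; last exact: PJ.
have [Q JQ] := ex_maximal_above J; move=> /JQ Qa; apply: contraT => /negP nPa.
have [C hC CP] := height_chain P.
have [||D [hD _]] := prime_chain_rcons hC CP (P := Q).
- by move=> b /PJ/JQ.
- by move/(_ a Qa).
by have := leq_trans (dimR hD) le_dP; rewrite ltnn.
Qed.

(** Since [s`_k] is regular modulo [J], the multiplicative set of all
    [t * s`_k ^+ n] with [t] outside [P] misses [J], so some prime between [J] and
    [P] omits [s`_k]: a regular sequence yields a chain of its own length. *)
Lemma regular_seq_chain (s : seq R) P : regular_seq s ->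
    (forall a, a \in s -> a \in P) ->
  exists2 C, prime_chain (size s) C & C (size s) =i P.
Proof.
move=> [sreg _] sP.
suff chain k : (k <= size s)%N -> forall Q : prime_idealr R,
    (forall a, gen_ideal (take k s) a -> a \in Q) ->
    exists2 C, prime_chain k C & C k =i Q.
  apply: (chain (size s)) => //; rewrite take_size.
  exact: (gen_ideal_min (ideal_set_idealr P)).
elim: k => [|k IHk] lt_k Q hQ; first by exists (fun=> Q).
rewrite (gen_ideal_takeS lt_k) in hQ.
have hJ := ideal_gen_ideal (take k s).
set J := gen_ideal (take k s) in IHk hQ hJ; set y := s`_k in hQ.
have JQ a : J a -> a \in Q by move=> Ja; apply/hQ/sub_adjoin.
pose T := [set t | exists (u : R) n, u \notin Q /\ t = u * y ^+ n].
have [||_ [u [n [nQu ->]]]|P' [JP' TP']] := @prime_avoiding R noethR J T hJ.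
- by exists 1, 0%N; rewrite idealr1 mulr1.
- move=> _ _ [u [m [nQu ->]]] [v [n [nQv ->]]]; exists (u * v), (m + n)%N.
  rewrite prime_idealrM (negPf nQu) (negPf nQv) exprD.
  by split=> //; rewrite mulrACA.
- elim: n => [|n IHn]; first by rewrite mulr1 => /JQ; apply/negP.
  by rewrite exprS mulrCA => /(sreg _ _ lt_k).
have P'Q : {subset P' <= Q}.
  move=> a; apply: contraLR => nQa; apply: TP'.
  by exists a, 0%N; rewrite mulr1.
have [C hC CP'] := IHk (ltnW lt_k) P' JP'.
have [|C' [hC' C'Q]] := prime_chain_rcons hC CP' P'Q; last by exists C'.
move/(_ y (hQ y (mem_adjoin y hJ))); apply/negP/TP'.
by exists 1, 1%N; rewrite idealr1 mul1r.
Qed.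

Lemma regular_seq_size (s : seq R) : regular_seq s -> (size s <= d)%N.
Proof.
move=> sreg; have [I hI] := ideal_setP (ideal_gen_ideal s) sreg.2.
have [P IP] := ex_maximal_above I.
have [|C /dimR//] := @regular_seq_chain s P sreg.
by move=> a sa; apply/IP/hI/mem_gen_ideal.
Qed.

Lemma grade_seq (I : idealr R) : exists s, [/\ regular_seq s,
  size s = grade [set` I], (forall a, a \in s -> a \in I) &
  forall t, regular_seq t -> (forall a, a \in t -> a \in I) ->
    (size t <= size s)%N].
Proof.
have [||[s [sreg sI] es] smax] := @supremum_nat_max
  [set size s | s in [set s | regular_seq s /\
                             forall x, x \in s -> x \in I]] d 0%N.
- by move=> _ [s [/regular_seq_size sd _] <-].
- exists [::] => //; split=> //; split=> // /gen_ideal_nil/eqP.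
  by rewrite oner_eq0.
exists s; split=> // t treg tI; rewrite es; apply: smax.
by exists t.
Qed.

End Heights.

(** * Localization at a prime *)

Section Localize.
Variables (R : comNzRingType) (p : prime_idealr R).
Local Notation L := (loc p).
Implicit Types (a b c z : R) (s t u : loc_den p) (J : set R).
Local Notation dv := (@loc_den_val R p).

Definition frac a s : L := \pi_(loc p)%qT (a, s).

Lemma frac_surj (x : L) : exists a s, x = frac a s.
Proof. by have [[a s] ->] := loc_pi_surj x; exists a, s. Qed.

Lemma frac_eq a s b t : frac a s = frac b t <->
  exists u, dv u * (a * dv t - b * dv s) = 0.
Proof. exact: loc_piP. Qed.

Lemma dv_notin s : dv s \notin p. Proof. exact: (svalP s). Qed.

Lemma fracD a s b t :
  frac a s + frac b t = frac (a * dv t + b * dv s) (loc_denM s t).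
Proof. exact: (loc_pi_add (a, s) (b, t)). Qed.

Lemma fracM a s b t : frac a s * frac b t = frac (a * b) (loc_denM s t).
Proof. exact: (loc_pi_mul (a, s) (b, t)). Qed.

Lemma frac0 s : frac 0 s = 0.
Proof. by apply/frac_eq; exists s; rewrite !mul0r subrr mulr0. Qed.

Lemma frac1 : 1 = frac 1 (loc_den1 p). Proof. by []. Qed.

Lemma frac_eq0 a s : frac a s = 0 <-> exists u, dv u * a = 0.
Proof.
rewrite -(frac0 s) frac_eq; split=> [[u hu]|[u hu]].
  exists (loc_denM u s); move: hu; rewrite mul0r subr0 => <-.
  by rewrite -[dv (loc_denM u s)]/(dv u * dv s); ring.
by exists u; rewrite mul0r subr0 mulrA hu mul0r.
Qed.

Lemma notin_den a : a \notin p -> exists s, dv s = a.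
Proof. by move=> pa; exists (exist _ a pa). Qed.

(** The extension of [J] to the localization; fractions with numerator in [J]
    are already closed under addition and multiplication. *)
Definition loc_ext J : set L := [set x | exists a s, J a /\ x = frac a s].

Lemma loc_ext_ideal J : ideal_set J -> ideal_set (loc_ext J).
Proof.
move=> hJ; split=> [|_ _ [a [s [Ja ->]]] [b [t [Jb ->]]]|x _ [a [s [Ja ->]]]].
- by exists 0, (loc_den1 p); rewrite frac0; split=> //; apply: ideal_set0.
- exists (a * dv t + b * dv s), (loc_denM s t); rewrite fracD; split=> //.
  by apply: ideal_setD => //; apply: ideal_setMr.
- have [b [t ->]] := frac_surj x; exists (b * a), (loc_denM t s).
  by rewrite fracM; split=> //; apply: ideal_setM.
Qed.

Lemma mem_loc_ext J a s : ideal_set J -> loc_ext J (frac a s) <->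
  exists u, J (dv u * a).
Proof.
move=> hJ; split=> [[b [t [Jb /frac_eq[u hu]]]]|[u Jua]].
  exists (loc_denM u t); rewrite -[dv (loc_denM u t)]/(dv u * dv t).
  have -> : dv u * dv t * a = dv u * (a * dv t - b * dv s) + dv u * dv s * b.
    by ring.
  by rewrite hu add0r; apply: ideal_setM.
exists (dv u * a), (loc_denM u s); split=> //; apply/frac_eq.
exists (loc_den1 p); rewrite -[dv (loc_denM u s)]/(dv u * dv s).
by rewrite [X in _ * X](_ : _ = 0) ?mulr0 //; ring.
Qed.

Lemma mem_loc_ext_prime (P : prime_idealr R) a s : {subset P <= p} ->
  loc_ext [set` P] (frac a s) <-> a \in P.
Proof.
move=> Pp; rewrite (mem_loc_ext _ _ (ideal_set_idealr P)); split=> [[u] /=|Pa].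
  rewrite prime_idealrM => /orP[/Pp pu|//].
  by have := dv_notin u; rewrite pu.
by exists (loc_den1 p); apply: idealMr.
Qed.

Lemma loc_prime (P : prime_idealr R) : {subset P <= p} ->
  exists P' : prime_idealr L, forall a s, (frac a s \in P') <-> a \in P.
Proof.
move=> Pp; have hP := loc_ext_ideal (ideal_set_idealr P).
have [||P' hP'] := prime_setP hP.
- by rewrite frac1 mem_loc_ext_prime // idealr1.
- move=> x y; have [a [s ->]] := frac_surj x; have [b [t ->]] := frac_surj y.
  by rewrite fracM !mem_loc_ext_prime // prime_idealrM => /orP.
by exists P' => a s; rewrite hP' mem_loc_ext_prime.
Qed.

Lemma loc_contract (P' : prime_idealr L) :
  exists P : prime_idealr R, forall a s, (frac a s \in P') <-> a \in P.
Proof.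
have unit_den a s t : (frac a s \in P') <-> (frac a t \in P').
  suff h u v : frac a u \in P' -> frac a v \in P' by split; apply: h.
  have -> : frac a v = frac (dv u) v * frac a u.
    rewrite fracM; apply/frac_eq; exists (loc_den1 p).
    rewrite -[dv (loc_denM v u)]/(dv v * dv u).
    by rewrite [X in _ * X](_ : _ = 0) ?mulr0 //; ring.
  exact: idealMr.
pose o := loc_den1 p; have o1 : dv o = 1 by [].
pose J := [set a | frac a o \in P'].
have hJ : ideal_set J.
  split=> [|a b Ja Jb|r a Ja]; rewrite /J /=.
  - by rewrite frac0 idealr0.
  - have := rpredD Ja Jb; rewrite fracD o1 !mulr1 => h.
    by apply/(unit_den _ _ (loc_denM o o)).
  - apply/(unit_den _ _ (loc_denM o o)); rewrite -fracM; exact: idealMr.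
have [||P hP] := prime_setP hJ.
- by rewrite /J /= -frac1 idealr1.
- move=> a b; rewrite /J /= => /(unit_den _ _ (loc_denM o o)).
  by rewrite -fracM prime_idealrM => /orP.
by exists P => a s; rewrite hP; apply: unit_den.
Qed.

Lemma loc_chain_contract n (C' : nat -> prime_idealr L) : prime_chain n C' ->
  exists C : nat -> prime_idealr R, prime_chain n C.
Proof.
move=> hC'; pose C i := projT1 (cid (loc_contract (C' i))).
have hC i a s : (frac a s \in C' i) <-> a \in C i.
  exact: (projT2 (cid (loc_contract (C' i)))).
exists C => i lt_i; have [sub nsub] := hC' i lt_i; split.
  by move=> a /(hC i a (loc_den1 p))/sub/hC.
move=> h; apply: nsub => x; have [a [s ->]] := frac_surj x.
by move=> /hC/h/hC.
Qed.

Lemma loc_chain_extend n (C : nat -> prime_idealr R) : prime_chain n C ->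
  (forall i, (i <= n)%N -> {subset C i <= p}) ->
  exists C' : nat -> prime_idealr L, prime_chain n C'.
Proof.
move=> hC Cp; have ex i : exists P' : prime_idealr L,
    (i <= n)%N -> forall a s, (frac a s \in P') <-> a \in C i.
  have [le_i|] := boolP (i <= n)%N.
    by have [P' hP'] := loc_prime (Cp i le_i); exists P'.
  by have [P' _] := @loc_prime p (fun a h => h); exists P'.
pose C' i := projT1 (cid (ex i)).
have hC' i : (i <= n)%N -> forall a s, (frac a s \in C' i) <-> a \in C i.
  exact: (projT2 (cid (ex i))).
exists C' => i lt_i; have le_i := ltnW lt_i; have [sub nsub] := hC i lt_i.
split=> [x|h].
  by have [a [s ->]] := frac_surj x => /(hC' i le_i)/sub/(hC' i.+1 lt_i).
apply: nsub => a /(hC' i.+1 lt_i a (loc_den1 p))/h.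
by move=> /(hC' i le_i).
Qed.

Lemma krull_dim_loc d :
    (forall n (C : nat -> prime_idealr R), prime_chain n C -> (n <= d)%N) ->
  (height p <= krull_dim L)%N.
Proof.
move=> dimR; have [C hC Cp] := height_chain dimR p.
have [|C' hC'] := loc_chain_extend hC.
  by move=> i le_i a /(prime_chain_sub hC le_i); rewrite Cp.
have [||_ ] := @supremum_nat_max
  [set n | exists P, @prime_chain L n P] d (height p).
- by move=> n [D /loc_chain_contract[E /dimR]].
- by exists C'.
by apply; exists C'.
Qed.

Lemma loc_maximal (m : idealr L) a s : frac a s \in m -> a \in p.
Proof.
move=> ma; apply: contraT => /notin_den[t ta].
have /negP[] : (1 : L) \notin m by rewrite idealr1.
have -> : (1 : L) = frac (dv s) t * frac a s.
  rewrite fracM frac1; apply/frac_eq; exists (loc_den1 p).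
  rewrite -[dv (loc_denM t s)]/(dv t * dv s) -[dv (loc_den1 p)]/(1 : R) ta.
  by ring.
exact: idealMr.
Qed.

(** If the maximal ideal of the local ring is the annihilator of an element
    modulo a regular sequence of length at most one, then that sequence is as
    long as any regular sequence in the maximal ideal.  In length one, the
    socle element [z] modulo [x] transports to the socle element [w] modulo
    [y], where [y * z = x * w]. *)
Lemma depth_loc_le (s : seq R) z : regular_seq s -> (size s <= 1)%N ->
  (forall a, a \in p <-> gen_ideal s (a * z)) -> (depth L <= size s)%N.
Proof.
move=> [sreg s1] size_s hz.
apply: supremum_nat_le => _ [l [[lreg l1] lm] <-].
have lp i a t : (i < size l)%N -> l`_i = frac a t -> a \in p.
  move=> lt_i e; have [m _] := lm _ (mem_nth 0 lt_i).
  by rewrite e; apply: loc_maximal.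
have z_p u : ~ gen_ideal s (dv u * z) by move/hz; apply/negP/dv_notin.
case: s size_s sreg s1 hz z_p => [|x [|//]] _ sreg s1 hz z_p.
  rewrite leqn0 size_eq0; apply: contraT; rewrite -size_eq0 -lt0n => l0.
  have [a [t e]] := frac_surj l`_0.
  have /hz/gen_ideal_nil az := lp 0%N a t l0 e.
  have : frac z (loc_den1 p) = 0.
    apply: (@gen_ideal_nil L); rewrite -(take0 l); apply: (lreg 0%N _ l0).
    by rewrite e fracM az frac0; apply: gen_ideal0.
  move/frac_eq0=> [u uz]; case: (z_p u); rewrite uz.
  exact: gen_ideal0.
have xreg c : x * c = 0 -> c = 0.
  move=> xc; apply: gen_ideal_nil; apply: (sreg 0%N) => //=.
  by rewrite xc; apply: gen_ideal0.
rewrite leqNgt; apply/negP => l2; have l0 := ltnW l2.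
have yreg (c : L) : l`_0 * c = 0 -> c = 0.
  move=> yc; apply: (@gen_ideal_nil L); rewrite -(take0 l); apply: (lreg 0%N _ l0).
  by rewrite yc; apply: gen_ideal0.
have [a [s ea]] := frac_surj l`_0; have [b [t eb]] := frac_surj l`_1.
(* The socle element modulo [l`_0] is the fraction with numerator [r]: it is
   killed by [l`_1] modulo [l`_0], against regularity. *)
have /hz/gen_ideal1[r er] := lp 0%N a s l0 ea.
have /hz/gen_ideal1[q eq] := lp 1%N b t l2 eb.
have yz : l`_0 * frac z (loc_den1 p) = frac x (loc_den1 p) * frac r s.
  rewrite ea !fracM er; apply/frac_eq; exists (loc_den1 p).
  rewrite -[dv (loc_denM _ s)]/(1 * dv s) -[dv (loc_denM s _)]/(dv s * 1).
  by rewrite [X in _ * X](_ : _ = 0) ?mulr0 //; ring.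
have brq : b * r = a * q.
  apply/eqP; rewrite -subr_eq0; apply/eqP/xreg.
  have -> : x * (b * r - a * q) = b * (r * x) - a * (q * x) by ring.
  by rewrite -er -eq; ring.
have : gen_ideal (take 1 l) (frac r s).
  apply: (lreg 1%N _ l2); rewrite (take_nth 0) // take0 ea.
  apply/gen_ideal1; exists (frac q t).
  by rewrite eb !fracM brq mulrC.
rewrite (take_nth 0) // take0 => /gen_ideal1[c ec].
have : l`_0 * (frac z (loc_den1 p) - frac x (loc_den1 p) * c) = 0.
  by rewrite mulrBr yz ec; ring.
move/yreg/eqP; rewrite subr_eq0 => /eqP; have [d [v ->]] := frac_surj c.
rewrite fracM => /frac_eq[u].
rewrite -[dv (loc_denM _ v)]/(1 * dv v) -[dv (loc_den1 p)]/(1 : R) => hu.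
apply: (z_p (loc_denM u v)); apply/gen_ideal1; exists (dv u * d).
rewrite -[dv (loc_denM u v)]/(dv u * dv v); apply/eqP.
by rewrite -subr_eq0 -hu; apply/eqP; ring.
Qed.

End Localize.

(** * Associated primes of an unmixed ideal *)

Section UnmixedIdeals.
Variables (R : comNzRingType) (I : idealr R).
Implicit Types (a b z : R) (s : seq R).

Definition quot_pi (V : lmodType R) (S : submodClosed V) (x : V) : quotmod S :=
  \pi_(Quotient.quot (submod_zmod S))%qT x.

Lemma quot_piP (V : lmodType R) (S : submodClosed V) (x y : V) :
  quot_pi S x = quot_pi S y <-> x - y \in S.
Proof. exact: quotmod_piP. Qed.

Fact quot_pi_is_linear (V : lmodType R) (S : submodClosed V) :
  linear (@quot_pi V S).
Proof.
move=> a x y; rewrite /quot_pi quotmod_piD; congr (_ + _).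
by rewrite -quotmod_scale_pi.
Qed.

HB.instance Definition _ (V : lmodType R) (S : submodClosed V) :=
  GRing.isLinear.Build R V (quotmod S) _ (@quot_pi V S) (@quot_pi_is_linear V S).

Lemma quot_pi_surj (V : lmodType R) (S : submodClosed V) (u : quotmod S) :
  exists x, u = quot_pi S x.
Proof. exact: quotmod_pi_surj. Qed.

Lemma ass_prime_quotP (q : prime_idealr R) :
  associated_prime (quotmod (ideal_submod I)) q <->
  exists b, forall a, (a \in q) <-> a * b \in I.
Proof.
have E a (b : R^o) : (a *: quot_pi (ideal_submod I) b == 0) = (a * b \in I).
  rewrite -linearZ -(linear0 (quot_pi (ideal_submod I))).
  by apply/eqP/idP; rewrite quot_piP subr0.
split=> [[m hm]|[b hb]].
  have [b mb] := quot_pi_surj m; exists b => a.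
  by rewrite hm mb E.
exists (quot_pi (ideal_submod I) b) => a; rewrite E.
by have [h1 h2] := hb a; apply/idP/idP.
Qed.

Lemma max_regular_zero_divisors s :
    regular_seq s -> (forall a, a \in s -> a \in I) ->
    (forall t, regular_seq t -> (forall a, a \in t -> a \in I) ->
      (size t <= size s)%N) ->
  forall a, a \in I -> exists2 w, ~ gen_ideal s w & gen_ideal s (a * w).
Proof.
move=> [sreg s1] sI smax a Ia; apply: contrapT => no.
have saI b : b \in rcons s a -> b \in I.
  by rewrite mem_rcons inE => /orP[/eqP->//|]; apply: sI.
suff : (size (rcons s a) <= size s)%N by rewrite size_rcons ltnn.
apply: smax => //; split; last first.
  by move/(gen_ideal_min (ideal_set_idealr I) saI); rewrite /= idealr1.
move=> i b; rewrite size_rcons ltnS leq_eqVlt => /orP[/eqP->|lt_i].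
  rewrite nth_rcons ltnn eqxx -cats1 take_size_cat // => Jab.
  by apply: contrapT => nJb; apply: no; exists b.
by rewrite nth_rcons lt_i -cats1 takel_cat ?(ltnW lt_i) //; apply: sreg.
Qed.

Hypotheses (noethR : noetherian R) (localR : local_ring R).
Hypotheses (dimR : krull_dim R = 3) (S2R : S2 R).

(** Locally at an associated prime [q] of R/I the depth of R is the grade of [I],
    that is, [q] is associated to R/(s) for a maximal regular sequence [s] in [I].
    Some associated prime [P] of R/(s) contains [I], and Serre's condition at [P]
    bounds [size s] from below by the smaller of 2 and the height of [I].  When
    that height is at most 2, [q] has height at most [size s], so it is minimal
    over (s).  When it is 3, both [P] and [q] are the maximal ideal. *)
Lemma unmixed_socle s (q : prime_idealr R) : regular_seq s ->
    (forall a, a \in s -> a \in I) ->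
    (forall t, regular_seq t -> (forall a, a \in t -> a \in I) ->
      (size t <= size s)%N) ->
    {subset I <= q} -> height q = ideal_height I ->
  exists z, forall a, (a \in q) <-> gen_ideal s (a * z).
Proof.
move=> sreg sI smax Iq htq.
have chain3 n (C : nat -> prime_idealr R) : prime_chain n C -> (n <= 3)%N.
  by move=> hC; apply: (supremum_nat_bound dimR); exists C.
have [P [z [hP IP]]] := zero_divisors_ass noethR (ideal_gen_ideal s) sreg.2
  (ideal_set_idealr I) (max_regular_zero_divisors sreg sI smax).
have htIP : (height q <= height P)%N by rewrite htq; apply: (ideal_height_le IP).
have grade_ge : (minn 2 (height P) <= size s)%N.
  have [size_s|size_s] := leqP (size s) 1; last by rewrite geq_min size_s.
  apply: leq_trans (depth_loc_le sreg size_s hP); apply: leq_trans (S2R P).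
  by rewrite leq_min geq_minl geq_min (krull_dim_loc P chain3) orbT.
(* [P] and [q] have full height. *)
have [htq2|htq3] := leqP (height q) 2; last first.
  have [m _ mmax] := localR; exists z => a.
  have -> : (a \in q) = (a \in P).
    rewrite !mmax //; apply: (height_top_maximal chain3) => //.
    exact: leq_trans htIP.
  exact: hP.
have sq : forall a, gen_ideal s a -> a \in q.
  by apply: (gen_ideal_min (ideal_set_idealr q)) => a /sI/Iq.
apply: (minimal_prime_ass noethR (ideal_gen_ideal s) sq) => P' sP' P'q.
apply: contrapT => nqP'.
have [|C hC CP'] := regular_seq_chain noethR sreg (P := P').
  by move=> a sa; apply/sP'/mem_gen_ideal.
have [C' [hC' C'q]] := prime_chain_rcons hC CP' P'q nqP'.
have := height_ge chain3 hC' C'q; rewrite ltnNge => /negP; apply.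
by apply: leq_trans grade_ge; rewrite leq_min htq2.
Qed.

End UnmixedIdeals.

(** * Projective resolutions *)

Section Resolutions.
Variable R : comNzRingType.
Implicit Types (M U V P : lmodType R).

Definition mk_linear U V (f : U -> V) (fl : linear f) : {linear U -> V} :=
  HB.pack f (GRing.isLinear.Build R U V _ f fl).

(** The lifting property against a map whose image merely contains that of [f]. *)
Lemma projective_lift P U V (g : {linear U -> V}) (f : {linear P -> V}) :
    projective P -> (forall x, exists u, g u = f x) ->
  exists h : {linear P -> U}, forall x, g (h x) = f x.
Proof.
move=> projP fim.
have gim u : g u \in im g by apply/asboolP; exists u.
have {}fim x : f x \in im g by apply/asboolP; apply: fim.
pose g1 (u : U) : submod (im g) := exist _ (g u) (gim u).
pose f1 (x : P) : submod (im g) := exist _ (f x) (fim x).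
have g1l : linear g1 by move=> a u v; apply: val_inj; rewrite /= linearP.
have f1l : linear f1 by move=> a u v; apply: val_inj; rewrite /= linearP.
have [v|h hh] := projP U _ (mk_linear g1l) (mk_linear f1l).
  have [u gu] := asboolP _ (svalP v); exists u; exact: val_inj.
exists h => x; have := hh x; by move/(congr1 val).
Qed.

Lemma projective_rV n : projective 'rV[R]_n.
Proof.
move=> U V g f gsurj; pose u j := projT1 (cid (gsurj (f (delta_mx 0 j)))).
have gu j : g (u j) = f (delta_mx 0 j).
  exact: (projT2 (cid (gsurj (f (delta_mx 0 j))))).
pose h (v : 'rV[R]_n) := \sum_j v 0 j *: u j.
have hl : linear h.
  move=> a v w; rewrite /h scaler_sumr -big_split /=; apply: eq_bigr => j _.
  by rewrite !mxE scalerDl scalerA.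
exists (mk_linear hl) => v; rewrite [in RHS](row_sum_delta v) !linear_sum.
by apply: eq_bigr => j _; rewrite !linearZ /= gu.
Qed.

Lemma projective_malg M : projective {malg R[M]}.
Proof.
move=> U V g f gsurj; pose u m := projT1 (cid (gsurj (f << m >>))).
have gu m : g (u m) = f << m >> by exact: (projT2 (cid (gsurj (f << m >>)))).
pose h (c : {malg R[M]}) := \sum_(m <- msupp c) c@_m *: u m.
have wide (D : {fset M}) c : (msupp c `<=` D)%fset ->
    h c = \sum_(m <- D) c@_m *: u m.
  move=> sD; apply: big_fset_incl => // m _ /mcoeff_outdom->.
  by rewrite scale0r.
have hl : linear h.
  move=> a c d; pose D := (msupp (a *: c + d) `|` msupp c `|` msupp d)%fset.
  rewrite !(wide D) ?scaler_sumr -?big_split /=; first last.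
  - exact: fsubset_trans (fsubsetUl _ _) (fsubsetUl _ _).
  - exact: fsubset_trans (fsubsetUr _ _) (fsubsetUl _ _).
  - exact: fsubsetUr.
  by apply: eq_bigr => m _; rewrite mcoeffD mcoeffZ scalerDl scalerA.
exists (mk_linear hl) => c; rewrite [in RHS](monalgE c) !linear_sum.
apply: eq_bigr => m _; rewrite linearZ /= gu -linearZ; congr (f _).
by apply/malgP => k; rewrite mcoeffZ !mcoeffU mulrnAr mulr1.
Qed.

Record resolution M (X : nat -> lmodType R) (d : forall i, {linear X i.+1 -> X i})
    (e : {linear X 0%N -> M}) : Prop := Resolution {
  res_proj : forall i, projective (X i);
  res_surj : forall m, exists x, e x = m;
  res_exact0 : exact_at (d 0%N) e;
  res_exactS : forall i, exact_at (d i.+1) (d i) }.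

Arguments res_proj {M X d e} _ i : rename.

Lemma res_dd M (X : nat -> lmodType R) (d : forall i, {linear X i.+1 -> X i})
    (e : {linear X 0%N -> M}) : resolution d e ->
  forall i u, d i (d i.+1 u) = 0.
Proof. by move=> [_ _ _ ex] i u; apply/ex; exists u. Qed.

Lemma res_ed M (X : nat -> lmodType R) (d : forall i, {linear X i.+1 -> X i})
    (e : {linear X 0%N -> M}) : resolution d e -> forall u, e (d 0%N u) = 0.
Proof. by move=> [_ _ ex _] u; apply/ex; exists u. Qed.

Section Comparison.
Variables (M : lmodType R) (X Y : nat -> lmodType R).
Variables (dX : forall i, {linear X i.+1 -> X i}) (eX : {linear X 0%N -> M}).
Variables (dY : forall i, {linear Y i.+1 -> Y i}) (eY : {linear Y 0%N -> M}).
Hypotheses (resX : resolution dX eX) (resY : resolution dY eY).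

Lemma comparison : exists f : forall i, {linear X i -> Y i},
  (forall u, eY (f 0%N u) = eX u) /\
  forall i u, dY i (f i.+1 u) = f i (dX i u).
Proof.
(* Each map carries the property that makes the next lift possible. *)
pose T i := {f : {linear X i -> Y i} | forall u, exists w, dY i w = f (dX i u)}.
have step i (x : T i) :
    {y : T i.+1 | forall u, dY i (sval y u) = sval x (dX i u)}.
  case: x => f fb; apply: cid => /=.
  have [g hg] := @projective_lift _ _ _ (dY i) (f \o dX i) (res_proj resX i.+1) fb.
  have gb u : exists w, dY i.+1 w = g (dX i.+1 u).
    by apply/(res_exactS resY); rewrite hg /= (res_dd resX) linear0.
  by exists (exist _ g gb).
have [f0 hf0] := projective_lift (res_proj resX 0) (fun x => res_surj resY (eX x)).
have f0b u : exists w, dY 0%N w = f0 (dX 0%N u).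
  by apply/(res_exact0 resY); rewrite hf0 (res_ed resX).
pose x := nat_rect T (exist _ f0 f0b) (fun i x => sval (step i x)).
exists (fun i => sval (x i)); split=> // i u.
exact: (svalP (step i (x i))).
Qed.

Lemma nullhomotopy (f : forall i, {linear X i -> Y i}) :
    (forall u, eY (f 0%N u) = 0) ->
    (forall i u, dY i (f i.+1 u) = f i (dX i u)) ->
  exists h : forall i, {linear X i -> Y i.+1},
    (forall u, f 0%N u = dY 0%N (h 0%N u)) /\
    forall i u, f i.+1 u = dY i.+1 (h i.+1 u) + h i (dX i u).
Proof.
move=> f0 fd.
pose T i := {h : {linear X i -> Y i.+1} |
  forall u, dY i (f i.+1 u - h (dX i u)) = 0}.
have step i (x : T i) : {y : T i.+1 |
    forall u, f i.+1 u = dY i.+1 (sval y u) + sval x (dX i u)}.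
  case: x => h hb; apply: cid => /=.
  have [u|g hg] := @projective_lift _ _ _ (dY i.+1) (f i.+1 \- (h \o dX i))
    (res_proj resX i.+1).
    by apply/(res_exactS resY); apply: hb.
  have gb u : dY i.+1 (f i.+2 u - g (dX i.+1 u)) = 0.
    by rewrite linearB hg fd /= (res_dd resX) linear0 subr0 subrr.
  by exists (exist _ g gb) => u /=; rewrite hg /= subrK.
have [u|h0 hh0] := @projective_lift _ _ _ (dY 0%N) (f 0%N) (res_proj resX 0%N).
  by apply/(res_exact0 resY).
have h0b u : dY 0%N (f 1%N u - h0 (dX 0%N u)) = 0.
  by rewrite linearB hh0 fd subrr.
pose x := nat_rect T (exist _ h0 h0b) (fun i x => sval (step i x)).
exists (fun i => sval (x i)); split=> [u|i u]; first by rewrite hh0.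
exact: (svalP (step i (x i))).
Qed.

End Comparison.

Section OneResolution.
Variables (M : lmodType R) (X : nat -> lmodType R).
Variables (d : forall i, {linear X i.+1 -> X i}) (e : {linear X 0%N -> M}).
Hypothesis resX : resolution d e.

Lemma annihilator_nullhomotopy a : annihilator M a ->
  exists h : forall i, {linear X i -> X i.+1},
    (forall u, a *: u = d 0%N (h 0%N u)) /\
    forall i u, a *: u = d i.+1 (h i.+1 u) + h i (d i u).
Proof.
move=> aM; have scl i : linear (fun u : X i => a *: u).
  by move=> b u v; rewrite scalerDr !scalerA mulrC.
have [||h hh] := nullhomotopy resX resX (f := fun i => mk_linear (scl i)).
- by move=> u /=; rewrite linearZ /=; apply: aM.
- by move=> i u /=; rewrite linearZ.
by exists h.
Qed.

(** Beyond the length of a finite resolution the comparison maps vanish, so the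
    composite homotopic to the identity is zero there. *)
Lemma finite_projdim_contraction : finite_projdim M ->
  exists n, exists h : forall i, {linear X i -> X i.+1},
    forall i u, (n <= i)%N -> u = d i.+1 (h i.+1 u) + h i (d i u).
Proof.
move=> [n [Y [dY [eY [projY surjY ex0 exS Y0]]]]].
have resY : resolution dY eY by [].
have [f [ef fd]] := comparison resX resY.
have [g [eg gd]] := comparison resY resX.
pose k i := idfun \- (g i \o f i) : {linear X i -> X i}.
have [||h [_ hh]] := nullhomotopy resX resX (f := k).
- by move=> u; rewrite /= linearB eg ef subrr.
- by move=> i u; rewrite /= linearB gd fd.
exists n, h => i u le_ni; rewrite -hh /=.
by rewrite (Y0 i.+1 (le_ni : (n < i.+1)%N) (f i.+1 u)) linear0 subr0.
Qed.

End OneResolution.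

Lemma free_resolution M : resolution (free_diff M) (aug M).
Proof.
have augU (N : lmodType R) m : aug N << m >> = m.
  rewrite /aug /= /aug_fun msuppU oner_eq0 big_seq_fset1.
  by rewrite mcoeffUU scale1r.
have diff_val i (u : free_res M i.+1) :
    free_diff M i u = val (aug (syzygy M i.+1) u).
  by [].
have im_aug i (v : free_res M i) : aug (syzygy M i) v = 0 ->
    exists u, free_diff M i u = v.
  move/eqP => kv; exists << (exist _ v kv : syzygy M i.+1) >>.
  by rewrite diff_val augU.
have aug_diff i (u : free_res M i.+1) : aug (syzygy M i) (free_diff M i u) = 0.
  by apply/eqP; rewrite diff_val; apply: (valP (aug (syzygy M i.+1) u)).
split=> [i|m||i].
- exact: projective_malg.
- by exists << m >>; apply: augU.
- by move=> v; split=> [v0|[u <-]]; [apply: (im_aug 0%N) | apply: (aug_diff 0%N)].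
- move=> v; split=> [|[u <-]].
    by rewrite diff_val => v0; apply: (im_aug i.+1); apply: val_inj.
  by rewrite diff_val aug_diff.
Qed.

End Resolutions.

Arguments res_proj {R M X d e} _ i : rename.

(** * Ext and regular sequences *)

Section ExtRegular.
Variables (R : comNzRingType) (I : idealr R) (x : seq R).
Hypotheses (xreg : regular_seq x) (xI : forall a, a \in x -> a \in I).
Implicit Types (a b y : R).

Local Notation RI := (quotmod (ideal_submod I)).
Local Notation J k := (gen_ideal (take k x)).
Local Notation g := (size x).

Let hJ k : ideal_set (J k) := ideal_gen_ideal (take k x).

(** Division by [y] modulo [K] of a functional with values in [K] + (y), obtained
    by lifting along multiplication by [y] from R to R/K. *)
Lemma projective_lift_mod (K : set R) y (P : lmodType R) (f : {linear P -> R^o}) :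
    ideal_set K -> projective P -> (forall u, adjoin K y (f u)) ->
  exists h : {linear P -> R^o}, forall u, K (f u - y * h u).
Proof.
move=> hK projP fK.
have SK : @submod_closed R R^o [pred a | `[< K a >]].
  split=> [|r b c]; rewrite !inE; first by apply/asboolP; apply: ideal_set0 hK.
  move=> /asboolP Kb /asboolP Kc; apply/asboolP.
  by apply: (ideal_setD hK) => //; apply: (ideal_setM hK).
pose S := mk_submod SK.
have inS (b : R^o) : b \in S <-> K b by split=> /asboolP.
have yl : linear (fun r : R^o => y * r : R^o).
  by move=> r b c; rewrite mulrDr -[r *: b]/(r * b) mulrCA.
have [u|h hh] := @projective_lift R P _ _ (quot_pi S \o mk_linear yl)
  (quot_pi S \o f) projP.
  have [r Kr] := fK u; exists r; apply/quot_piP/inS => /=.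
  by rewrite -opprB mulrC; apply: (ideal_setN hK).
exists h => u; have /esym/quot_piP/inS := hh u; exact.
Qed.

Lemma annihilator_quot a : a \in I -> annihilator RI a.
Proof.
move=> Ia m; have [b ->] := quot_pi_surj m.
rewrite -linearZ -(linear0 (quot_pi (ideal_submod I))).
by apply/quot_piP; rewrite subr0 [_ *: _]mulrC; apply: idealMr.
Qed.

Let x_mem k : (k < g)%N -> x`_k \in I.
Proof. by move=> lt_k; apply/xI/mem_nth. Qed.

Section Cochains.
Variables (X : nat -> lmodType R) (d : forall i, {linear X i.+1 -> X i}).
Variables (e : {linear X 0%N -> RI}).
Hypothesis resX : resolution d e.

(** The cochain [phi] with values in R is a coboundary modulo the ideal [K]. *)
Definition cobounds (K : set R) i : (X i -> R) -> Prop :=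
  match i return (X i -> R) -> Prop with
  | 0 => fun phi => forall u, K (phi u)
  | j.+1 => fun phi =>
    exists chi : {linear X j -> R^o}, forall u, K (phi u - chi (d j u))
  end.

(** Ext^i(R/I, R/J) vanishes when [J] is generated by fewer than [g - i] terms of
    a regular sequence in [I]: a cocycle times the next term [y] of the sequence is
    a coboundary, because [y] is nullhomotopic on the resolution, and the cochain it
    bounds is a cocycle in degree [i - 1] modulo one more term. *)
Lemma ext_regular_vanish i k (phi : {linear X i -> R^o}) : (i + k < g)%N ->
  (forall u, J k (phi (d i u))) -> cobounds (J k) phi.
Proof.
elim: i k phi => [|i IHi] k phi lt_g cyc.
  have lt_k : (k < g)%N by [].
  have [h [h0 _]] := annihilator_nullhomotopy resX (annihilator_quot (x_mem lt_k)).
  move=> u; apply: xreg.1 => //.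
  by rewrite -[_ * _]/(x`_k *: phi u) -linearZ /= h0; apply: cyc.
have lt_k : (k < g)%N by apply: leq_ltn_trans lt_g; apply: leq_addl.
have [h [_ hS]] := annihilator_nullhomotopy resX (annihilator_quot (x_mem lt_k)).
set y := x`_k in hS.
have yphi w : J k (y * phi w - phi (h i (d i w))).
  rewrite -[y * _]/(y *: phi w) -linearZ -linearB hS addrK.
  exact: cyc.
have lt_g' : (i + k.+1 < g)%N by rewrite addnS.
have cyc' u : J k.+1 (phi (h i (d i u))).
  rewrite (gen_ideal_takeS lt_k) -/y; exists (phi u); rewrite mulrC -opprB.
  exact: (ideal_setN (hJ k)).
have finish (chi : {linear X i -> R^o}) :
    (forall w, J k (phi (h i (d i w)) - y * chi (d i w))) -> cobounds (J k) phi.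
  move=> hchi; exists chi => u; apply: xreg.1 => //.
  rewrite mulrBr -(subrKA (phi (h i (d i u)))); exact: (ideal_setD (hJ k)).
have {IHi} := IHi k.+1 (phi \o h i) lt_g' cyc'.
case: i phi h lt_g cyc hS yphi lt_g' cyc' finish
  => [|i] phi h lt_g cyc hS yphi lt_g' cyc' finish.
  rewrite (gen_ideal_takeS lt_k).
  move=> /(projective_lift_mod (hJ k) (res_proj resX 0%N)).
  by move=> [chi hchi]; apply: (finish chi) => w; apply: hchi.
move=> [theta]; rewrite (gen_ideal_takeS lt_k).
move=> /(@projective_lift_mod _ y _ (phi \o h i.+1 \- (theta \o d i)) (hJ k)
  (res_proj resX i.+1))[chi hchi].
apply: (finish chi) => w; have := hchi (d i.+1 w).
by rewrite /= (res_dd resX) linear0 subr0.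
Qed.

(** Iterated connecting maps embed Hom(R/I, R/(x)) into Ext^g(R/I, R); hence what
    kills the latter kills the former. *)
Lemma ext_annihilator_descend a :
    (forall psi : {linear X g -> R^o}, (forall u, psi (d g u) = 0) ->
      cobounds [set 0] (fun u => a * psi u)) ->
  forall y, (forall b, b \in I -> gen_ideal x (b * y)) -> gen_ideal x (a * y).
Proof.
move=> top y Iy.
have J0 : J 0 = [set 0].
  rewrite take0; apply/seteqP; split=> [b /gen_ideal_nil|_ ->] //.
  exact: gen_ideal0.
(* In cohomological degree [j], with coefficients modulo the first [k] terms. *)
have desc j k (psi : {linear X j -> R^o}) : (j + k)%N = g ->
    (forall u, J k (psi (d j u))) -> cobounds (J k) (fun u => a * psi u).
  elim: k j psi => [|k IHk] j psi.
    rewrite addn0 => ej; subst j => cyc; rewrite J0; apply: top => u.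
    by have := cyc u; rewrite J0.
  move=> ejk cyc; have lt_k : (k < g)%N by rewrite -ejk addnS ltnS leq_addl.
  have [u|psi' hpsi'] := @projective_lift_mod (J k) x`_k _ (psi \o d j) (hJ k)
    (res_proj resX j.+1).
    by rewrite -(gen_ideal_takeS lt_k); apply: cyc.
  have cyc' u : J k (psi' (d j.+1 u)).
    apply: xreg.1 => //; have := hpsi' (d j.+1 u).
    rewrite /= (res_dd resX) linear0 sub0r => /(ideal_setN (hJ k)).
    by rewrite opprK.
  have [|theta htheta] := IHk j.+1 psi' _ cyc'; first by rewrite addSnnS.
  have zl : linear (fun u : X j => (a * psi u - x`_k * theta u : R^o)).
    move=> r u v; rewrite (linearP psi) (linearP theta).
    have E (A B C D : R) : a * (r * A + B) - x`_k * (r * C + D) =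
      r * (a * A - x`_k * C) + (a * B - x`_k * D) by ring.
    exact: E.
  have cycz u : J k (mk_linear zl (d j u)).
    rewrite /=; have -> : a * psi (d j u) - x`_k * theta (d j u) =
      a * (psi (d j u) - x`_k * psi' u) + x`_k * (a * psi' u - theta (d j u)).
      by ring.
    by apply: (ideal_setD (hJ k)); apply: (ideal_setM (hJ k));
      [apply: hpsi' | apply: htheta].
  have lt_jk : (j + k < g)%N by rewrite -ejk addnS.
  have JkS b c : J k (b - x`_k * c) -> J k.+1 b.
    by rewrite (gen_ideal_takeS lt_k) mulrC; exists c.
  have {zl cycz} : cobounds (J k) (fun u => a * psi u - x`_k * theta u).
    exact: (ext_regular_vanish lt_jk cycz).
  case: j psi psi' hpsi' theta htheta {ejk cyc cyc' lt_jk}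
    => [|j] psi psi' hpsi' theta htheta /=.
    by move=> h u; apply: (JkS _ (theta u)).
  move=> [chi hchi]; exists chi => u; apply: (JkS _ (theta u)).
  by have := hchi u; rewrite addrAC.
(* [y] induces a map from R/I to R/(x); lift it to the resolution as [y * l]. *)
have [l hl] := projective_lift (res_proj resX 0%N) (g := quot_pi (ideal_submod I))
  (f := e) (fun u => let: ex_intro b eb := quot_pi_surj (e u) in
                     ex_intro _ b (esym eb)).
have yl : linear (fun u : X 0%N => (y * l u : R^o)).
  move=> r u v; rewrite (linearP l).
  have E (A B : R) : y * (r * A + B) = r * (y * A) + y * B by ring.
  exact: E.
have := desc 0%N g (mk_linear yl) (erefl _); rewrite take_size /=.
have lI u : l (d 0%N u) \in I.
  have : quot_pi (ideal_submod I) (l (d 0%N u)) = quot_pi (ideal_submod I) 0.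
    by rewrite hl (res_ed resX) linear0.
  by move/quot_piP; rewrite subr0.
move=> /(_ (fun u => eq_ind _ _ (Iy _ (lI u)) _ (mulrC _ _))) h.
have [u eu] := res_surj resX (quot_pi (ideal_submod I) 1).
have /quot_piP/Iy Jy :
  quot_pi (ideal_submod I) (l u) = quot_pi (ideal_submod I) 1 by rewrite hl.
 rewrite -(subKr (a * (y * l u)) (a * y)).
have hx := ideal_gen_ideal x; apply: (ideal_setB hx); first exact: h.
have -> : a * (y * l u) - a * y = a * ((l u - 1) * y) by ring.
exact: (ideal_setM hx).
Qed.

End Cochains.

Lemma ext_annihilator_cobounds (M : lmodType R) n a :
    annihilator (Ext n M R^o) a ->
  forall psi : {linear free_res M n -> R^o},
    (forall u, psi (free_diff M n u) = 0) ->
  cobounds (free_diff M) [set 0] (fun u => a * psi u).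
Proof.
move=> aExt psi cyc.
have psil : (psi : free_res M n -> R^o) \in
    mk_submod (@hom_closed R (free_res M n) R^o).
  by apply/asboolP; apply: linearP.
pose phi : hom (free_res M n) R^o := exist _ (psi : free_res M n -> R^o) psil.
have phiK : phi \in ker (codiff M R^o n).
  by apply/eqP; apply: val_inj; apply: funext => u; apply: cyc.
pose z : submod (ker (codiff M R^o n)) := exist _ phi phiK.
set S := preim_submod (\val : {linear submod (ker (codiff M R^o n)) -> _})
  (coboundary M R^o n).
have := aExt (quot_pi S z); rewrite -linearZ -(linear0 (quot_pi S)).
move=> /quot_piP; rewrite subr0 => {S}.
rewrite -[_ \in _]/(a *: phi \in coboundary M R^o n) => {aExt z}.
have phiE u : val (a *: phi) u = a * psi u by [].
case: n psi cyc psil phi phiK phiE => [|n] psi cyc psil phi _ phiE.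
  by move=> /eqP e u; rewrite -phiE e.
move=> /asboolP[chi e].
have chil : linear (val chi) by apply: hom_linear.
exists (mk_linear chil) => u.
by rewrite -phiE -e; apply: subrr.
Qed.

Lemma divisorial_colon a : size x = grade [set` I] -> divisorial I a ->
  forall y, (forall b, b \in I -> gen_ideal x (b * y)) -> gen_ideal x (a * y).
Proof.
rewrite /divisorial => <- aExt.
apply: (ext_annihilator_descend (free_resolution RI)).
exact: ext_annihilator_cobounds.
Qed.

End ExtRegular.

(** * Finite free resolutions over a Noetherian ring *)

Section FiniteFree.
Variable R : comNzRingType.
Hypothesis noethR : noetherian R.

(** Induction on the number of coordinates that may be nonzero: the last of them
    takes its values in a finitely generated ideal. *)
Lemma row_submodule_fg n (S : set 'rV[R]_n) : S 0 ->
    (forall a u v, S u -> S v -> S (a *: u + v)) ->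
  exists m (G : 'M[R]_(m, n)), forall u, S u <-> exists v, u = v *m G.
Proof.
suff fg k : (k <= n)%N -> forall S : set 'rV[R]_n, S 0 ->
    (forall a u v, S u -> S v -> S (a *: u + v)) ->
    (forall u (j : 'I_n), S u -> (k <= j)%N -> u 0 j = 0) ->
    exists m (G : 'M[R]_(m, n)), forall u, S u <-> exists v, u = v *m G.
  move=> S0 Slin; apply: (fg n) => // u j _; rewrite leqNgt ltn_ord //.
elim: k => [_ {}S S0 Slin Sk|k IHk lt_k {}S S0 Slin Sk].
  exists 0%N, 0 => u; split=> [Su|[v ->]]; last by rewrite mulmx0.
  by exists 0; rewrite mulmx0; apply/rowP => j; rewrite mxE Sk.
pose j := Ordinal lt_k.
have Ssum (I : finType) (w : I -> 'rV[R]_n) (c : I -> R) :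
    (forall i, S (w i)) -> S (\sum_i c i *: w i).
  by move=> Sw; elim/big_rec: _ => // i u _; apply: Slin.
pose J := [set a | exists2 u, S u & u 0 j = a].
have hJ : ideal_set J.
  split=> [|a b [u Su <-] [v Sv <-]|a b [u Su <-]].
  - by exists 0; rewrite ?mxE.
  - by exists (1 *: u + v); [apply: Slin | rewrite !mxE mul1r].
  - by exists (a *: u + 0); [apply: Slin | rewrite !mxE addr0].
have [s Js] := ideal_set_fg noethR hJ.
have lift (i : 'I_(size s)) : {u | S u /\ u 0 j = s`_i}.
  apply: cid; have : J s`_i by rewrite Js; apply: mem_gen_ideal; apply: mem_nth.
  by case=> u; exists u.
pose w i := sval (lift i); pose A := \matrix_i w i.
have wS i : S (w i) by case: (svalP (lift i)).
have wj i : w i 0 j = s`_i by case: (svalP (lift i)).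
have AE (c : 'rV_(size s)) : c *m A = \sum_i c 0 i *: w i.
  by rewrite mulmx_sum_row; apply: eq_bigr => i _; rewrite rowK.
have [|||m [G hG]] := IHk (ltnW lt_k) (S `&` [set u | u 0 j = 0]).
- by split=> //; rewrite /= mxE.
- move=> a u v [Su uj] [Sv vj]; split; first exact: Slin.
  by rewrite /= !mxE uj vj mulr0 addr0.
- move=> u i [Su uj]; rewrite leq_eqVlt => /orP[/eqP ki|lt_ki]; last exact: Sk.
  by rewrite -[RHS]uj; congr (u _ _); apply: val_inj.
exists (size s + m)%N, (col_mx A G) => u; split=> [Su|[v ->]]; last first.
  rewrite -[v]hsubmxK mul_row_col AE -[X in S (X + _)]scale1r; apply: Slin.
    exact: Ssum.
  by have /hG[] : exists v', rsubmx v *m G = v' *m G by exists (rsubmx v).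
have [c uc] : gen_ideal s (u 0 j) by rewrite -Js; exists u.
pose cv : 'rV_(size s) := \row_i c i.
have [|v hv] := (hG (-1 *: (cv *m A) + u)).1.
  split; first by apply: Slin => //; rewrite AE; apply: Ssum.
  rewrite /= !mxE uc mulN1r addrC; apply/eqP; rewrite subr_eq0; apply/eqP.
  by apply: eq_bigr => i _; rewrite !mxE wj.
by exists (row_mx cv v); rewrite mul_row_col -hv scaleN1r addNKr.
Qed.

Definition rmul m n (A : 'M[R]_(m, n)) : {linear 'rV[R]_m -> 'rV[R]_n} :=
  mulmxr A.

Definition free_row (r : nat -> nat) i : lmodType R := 'rV[R]_(r i).

(** The matrix of the boundary map leaving the free module of rank [srows]; the
    next one has [srows] columns by computation, as composability requires. *)
Record stage := Stage { srows; scols; smat : 'M[R]_(srows, scols) }.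

Lemma finite_free_resolution (I : idealr R) :
  exists (r : nat -> nat) (D : forall i, 'M[R]_(r i.+1, r i))
    (e : {linear 'rV[R]_(r 0%N) -> quotmod (ideal_submod I)}),
  @resolution R _ (free_row r) (fun i => rmul (D i)) e.
Proof.
have ker_gen (s : stage) : {m : nat & {G : 'M[R]_(m, srows s) |
    forall u : 'rV_(srows s), u *m smat s = 0 <-> exists v, u = v *m G}}.
  pose K : set 'rV[R]_(srows s) := [set u | u *m smat s = 0].
  have K0 : K 0 by rewrite /K /= mul0mx.
  have Klin a u v : K u -> K v -> K (a *: u + v).
    by rewrite /K /= => us vs; rewrite mulmxDl -scalemxAl us vs scaler0 addr0.
  have [m /cid[G hG]] := cid (row_submodule_fg K0 Klin).
  by exists m, G => u; apply: hG.
pose next s := Stage (sval (projT2 (ker_gen s))).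
have next_exact s (u : 'rV_(srows s)) :
    u *m smat s = 0 <-> exists v, u = v *m smat (next s).
  exact: (svalP (projT2 (ker_gen s))).
have [||m [G hG]] := @row_submodule_fg 1 [set u | u 0 0 \in I].
- by rewrite /= mxE idealr0.
- by move=> a u v /= Iu Iv; rewrite !mxE rpredD // idealMr.
pose st := fix st i := if i is j.+1 then next (st j) else Stage G.
pose r i := scols (st i); pose D i : 'M[R]_(r i.+1, r i) := smat (st i).
have el : linear (fun u : 'rV[R]_1 => quot_pi (ideal_submod I) (u 0 0)).
  by move=> a u v; rewrite !mxE -linearP.
exists r, D, (mk_linear el); split=> [i|x||i].
- exact: projective_rV.
- have [a ->] := quot_pi_surj x; exists (a%:M : 'rV_1) => /=.
  by rewrite mxE mulr1n.
- move=> u /=; split=> [|[v <-]].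
    rewrite -(linear0 (quot_pi (ideal_submod I))) => /quot_piP.
    by rewrite subr0 => /hG[v ->]; exists v.
  rewrite -(linear0 (quot_pi (ideal_submod I))); apply/quot_piP.
  by rewrite subr0; apply/hG; exists v.
- move=> u /=; split=> [/(next_exact (st i))[v ->]|[v <-]]; first by exists v.
  by apply/(next_exact (st i)); exists v.
Qed.

End FiniteFree.

Section FiniteProjdimQuotient.
Variable R : comNzRingType.

Lemma projective_regular : @projective R R^o.
Proof.
move=> U V g f gsurj; have [u gu] := gsurj (f 1).
have hl : linear (fun a : R^o => a *: u).
  by move=> a b c; rewrite scalerDl -scalerA.
exists (mk_linear hl) => a; rewrite /= linearZ /= gu -linearZ.
by congr (f _); apply: mulr1.
Qed.

(** Splicing [V] in degree 0 onto a resolution of [S] resolves V/S. *)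
Lemma finite_projdim_quot (V : lmodType R) (S : submodClosed V) :
  projective V -> finite_projdim (submod S) -> finite_projdim (quotmod S).
Proof.
move=> projV [n [P [d [e [projP esurj ex0 exS P0]]]]].
pose Q i : lmodType R := if i is j.+1 then P j else V.
pose dQ i : {linear Q i.+1 -> Q i} :=
  match i with
  | 0 => (\val : {linear submod S -> V}) \o e
  | j.+1 => d j
  end.
exists n.+1, Q, dQ, (quot_pi S); split=> [[|i]|x|||[|i] // lt_i x].
- exact: projV.
- exact: projP.
- by have [v ->] := quot_pi_surj x; exists v.
- move=> v; rewrite -(linear0 (quot_pi S)) quot_piP subr0.
  split=> [Sv|[u <-]]; last exact: valP.
  by have [u eu] := esurj (exist _ v Sv); exists u; rewrite /= eu.
- move=> [|i]; last exact: exS.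
  move=> v; rewrite -[dQ 1%N]/(d 0%N) -ex0 -[dQ 0%N v]/(val (e v)).
  split=> [e0|->]; last exact: raddf0.
  by apply: val_inj; rewrite e0 raddf0.
- exact: P0.
Qed.

End FiniteProjdimQuotient.

(** * Splitting matrices at a prime *)

Section GeneralizedInverse.

(** A generalized inverse over a domain, denominators cleared.  Row by row: the
    new row [v] is first reduced by the projection onto the
    earlier rows, and if a nonzero entry remains its column serves as pivot. *)
Lemma domain_ginverse (K : comNzRingType) m n (M : 'M[K]_(m, n)) :
    (forall a b : K, a * b = 0 -> a = 0 \/ b = 0) ->
  exists s N, s != 0 /\ M *m N *m M = s *: M.
Proof.
move=> dom; elim: m M => [|m IHm] M.
  by exists 1, 0; rewrite oner_neq0 !flatmx0.
rewrite -[m.+1]/(1 + m)%N in M *; rewrite -[M]vsubmxK.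
set v := usubmx M; set M' := dsubmx M.
have [s [N [s0 hN]]] := IHm M'; pose P := N *m M'.
have M'P : M' *m P = s *: M' by rewrite mulmxA hN.
have M'sP : M' *m (s%:M - P) = 0 by rewrite mulmxBr mul_mx_scalar M'P subrr.
pose w := v *m (s%:M - P).
have wE : w = s *: v - v *m P by rewrite /w mulmxBr mul_mx_scalar.
have [PE wV] : N *m M' = P /\ v *m (s%:M - P) = w by [].
clearbody P w; have [w0|] := eqVneq w 0.
  exists s, (row_mx 0 N); split=> //.
  rewrite -mulmxA mul_row_col mul0mx add0r PE mul_col_mx M'P scale_col_mx.
  by congr col_mx; apply/esym/eqP; rewrite -subr_eq0 -wE w0 eqxx.
case/rV0Pn=> j wj0; pose al := w 0 j.
pose c : 'cV[K]_n := delta_mx j 0.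
have wc : w *m c = al%:M.
  by apply/matrixP=> a b; rewrite !ord1 -colE mxE [RHS]mxE eqxx mulr1n.
pose Q := (s%:M - P) *m c.
exists (al * s), (row_mx (s *: Q) (al *: N - Q *m v *m N)).
split; first by apply/eqP=> /dom[/eqP|/eqP]; apply/negP.
rewrite -mulmxA mul_row_col.
have -> : (s *: Q) *m v + (al *: N - Q *m v *m N) *m M' = al *: P + Q *m w.
  by rewrite wE mulmxBr -scalemxAr mulmxBl -!scalemxAl -!mulmxA PE addrCA.
rewrite /Q.
rewrite mul_col_mx !mulmxDr -!scalemxAr M'P !mulmxA M'sP !mul0mx addr0.
rewrite wV wc mul_scalar_mx wE scale_col_mx scalerA scalerBr scalerA.
by rewrite addrCA subrr addr0.
Qed.

End GeneralizedInverse.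

Section MatricesModulo.
Variable R : comNzRingType.
Implicit Types (J K : set R) (a b : R).

Definition mx_mod J m n (A : 'M[R]_(m, n)) := forall i j, J (A i j).

Variable J : set R.
Hypothesis hJ : ideal_set J.

Lemma mx_mod0 m n : mx_mod J (0 : 'M[R]_(m, n)).
Proof. by move=> i j; rewrite mxE; apply: ideal_set0. Qed.

Lemma mx_modD m n (A B : 'M[R]_(m, n)) :
  mx_mod J A -> mx_mod J B -> mx_mod J (A + B).
Proof. by move=> hA hB i j; rewrite mxE; apply: ideal_setD. Qed.

Lemma mx_modZ m n a (A : 'M[R]_(m, n)) : mx_mod J A -> mx_mod J (a *: A).
Proof. by move=> hA i j; rewrite mxE; apply: ideal_setM. Qed.

Lemma mx_modN m n (A : 'M[R]_(m, n)) : mx_mod J A -> mx_mod J (- A).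
Proof. by move=> hA; rewrite -scaleN1r; apply: mx_modZ. Qed.

Lemma mx_mod_mulr m n p (A : 'M[R]_(m, n)) (B : 'M[R]_(n, p)) :
  mx_mod J A -> mx_mod J (A *m B).
Proof.
by move=> hA i j; rewrite mxE; apply: ideal_set_sum => // k _; apply: ideal_setMr.
Qed.

Lemma mx_mod_adjoin m n b (A : 'M[R]_(m, n)) : mx_mod (adjoin J b) A ->
  exists B : 'M[R]_(m, n), mx_mod J (A - b *: B).
Proof.
move=> hA; exists (\matrix_(i, j) sval (cid (hA i j))) => i j; rewrite !mxE.
by rewrite [b * _]mulrC; case: (cid _).
Qed.

Lemma adjoin_mx_mod m n b (A B : 'M[R]_(m, n)) : mx_mod J (A - b *: B) ->
  mx_mod (adjoin J b) A.
Proof. by move=> hA i j; exists (B i j); have := hA i j; rewrite !mxE mulrC. Qed.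

End MatricesModulo.

Lemma mx_mod_eq0 (R : comNzRingType) m n (A : 'M[R]_(m, n)) :
  mx_mod (gen_ideal [::]) A -> A = 0.
Proof. by move=> hA; apply/matrixP=> i j; rewrite mxE; apply/gen_ideal_nil. Qed.

Section PrimeModulo.
Variables (R : comNzRingType) (q : prime_idealr R).
Local Notation K := {ideal_quot q}.
Let piq : {rmorphism R -> K} := \pi_K%qT.

Let piq_eq0 a : (piq a == 0) = (a \in q).
Proof. by rewrite -[0](rmorph0 piq) -Quotient.idealrBE subr0. Qed.

Let piqK s : piq (repr s) = s.
Proof. exact: reprK. Qed.

Let map_piq m n (A B : 'M[R]_(m, n)) :
  map_mx piq A = map_mx piq B <-> mx_mod [set` q] (A - B).
Proof.
split=> [/matrixP e i j|e]; last apply/matrixP => i j.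
  by have /eqP := e i j; rewrite !mxE -subr_eq0 -rmorphB piq_eq0.
apply/eqP; rewrite !mxE -subr_eq0 -rmorphB piq_eq0.
by have := e i j; rewrite !mxE.
Qed.

Lemma prime_ginverse m n (M : 'M[R]_(m, n)) :
  exists s N, s \notin q /\ mx_mod [set` q] (M *m N *m M - s *: M).
Proof.
have [|s [N [s0 hN]]] := @domain_ginverse K m n (map_mx piq M).
  by move=> a b /Quotient.rquot_IdomainAxiom/orP[]/eqP; [left | right].
exists (repr s), (map_mx repr N); split; first by rewrite -piq_eq0 piqK.
apply/map_piq; rewrite !map_mxM map_mxZ.
have -> : map_mx piq (map_mx repr N) = N.
  by apply/matrixP=> i j; rewrite !mxE piqK.
by rewrite piqK.
Qed.

Lemma prime_det_scalar n s (Y : 'M[R]_n) : s \notin q -> mx_mod [set` q] Y ->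
  \det (s%:M + Y) \notin q.
Proof.
move=> qs hY; rewrite -piq_eq0 -det_map_mx.
have -> : map_mx piq (s%:M + Y) = (piq s)%:M.
  by rewrite -map_scalar_mx; apply/map_piq; rewrite addrC addKr.
rewrite det_scalar -rmorphXn piq_eq0; elim: n {Y hY} => [|n IHn].
  by rewrite idealr1.
by rewrite exprS prime_idealrM negb_or qs.
Qed.

End PrimeModulo.

(** * Tensoring a free resolution with a regular quotient *)

Section RegularTensor.
Variables (R : comNzRingType) (I : idealr R) (x : seq R).
Hypotheses (xreg : regular_seq x) (xI : forall a, a \in x -> a \in I).
Variables (r : nat -> nat) (D : forall i, 'M[R]_(r i.+1, r i)).
Variable e : {linear 'rV[R]_(r 0%N) -> quotmod (ideal_submod I)}.
Hypothesis resD : @resolution R _ (free_row R r) (fun i => rmul (D i)) e.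

Local Notation J k := (gen_ideal (take k x)).
Local Notation g := (size x).
Let hJ k : ideal_set (J k) := ideal_gen_ideal (take k x).

Let DD i : D i.+1 *m D i = 0.
Proof.
apply/row_matrixP => j; rewrite row_mul row0.
have := res_dd resD (i := i) (row j 1%:M).
by rewrite /= -row_mul mul1mx.
Qed.

Lemma mx_mod_regular k m n (A : 'M[R]_(m, n)) : (k < g)%N ->
  mx_mod (J k) (x`_k *: A) -> mx_mod (J k) A.
Proof.
by move=> lt_k hA i j; apply: xreg.1 => //; have := hA i j; rewrite mxE.
Qed.

(** Tor_(i+1)(R/I, R/J) vanishes when [J] is generated by [k <= i] terms of a
    regular sequence: a cycle modulo one more term [y] has boundary [y *: B] with
    [B] a cycle modulo [J] one degree lower, and when [B] bounds [w] the cycle may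
    be corrected by [y *: w]. *)
Lemma tor_vanish k i (u : 'rV[R]_(r i.+1)) : (k <= g)%N -> (k <= i)%N ->
  mx_mod (J k) (u *m D i) -> exists w, mx_mod (J k) (u - w *m D i.+1).
Proof.
elim: k i u => [|k IHk] i u lt_k le_ki hu.
  have [w <-] : exists w : free_row R r i.+2, w *m D i.+1 = u.
    apply/(res_exactS resD); apply: mx_mod_eq0; move: hu; by rewrite take0.
  by exists w; rewrite subrr; apply: mx_mod0.
case: i le_ki u hu => // i le_ki u; rewrite (gen_ideal_takeS lt_k).
move=> /mx_mod_adjoin[B hB].
have [|w hw] := IHk i B (ltnW lt_k) le_ki.
  apply: (mx_mod_regular lt_k); rewrite scalemxAl.
  rewrite -[X in mx_mod _ X]opprK; apply: mx_modN => //.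
  have -> : - (x`_k *: B *m D i) = (u *m D i.+1 - x`_k *: B) *m D i.
    by rewrite mulmxBl -mulmxA DD mulmx0 sub0r.
  exact: mx_mod_mulr.
have [|w' hw'] := IHk i.+1 (u - x`_k *: w) (ltnW lt_k) (leqW le_ki).
  rewrite mulmxBl -scalemxAl -(subrKA (x`_k *: B)) -scalerBr.
  by apply: mx_modD => //; apply: mx_modZ.
exists w'; apply: (adjoin_mx_mod (B := w)).
by rewrite addrAC.
Qed.

Lemma matrix_nullhomotopy b : b \in I -> exists H : forall i, 'M[R]_(r i, r i.+1),
  (forall u : 'rV_(r 0%N), b *: u = u *m H 0%N *m D 0%N) /\
  forall i (u : 'rV_(r i.+1)), b *: u = u *m H i.+1 *m D i.+1 + u *m D i *m H i.
Proof.
move=> Ib; have [h [h0 hS]] := annihilator_nullhomotopy resD (annihilator_quot Ib).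
exists (fun i => lin1_mx (h i)); split=> [u|i u].
  by rewrite mul_rV_lin1; apply: h0.
by rewrite !mul_rV_lin1; apply: hS.
Qed.

(** In degree 0 there is no outgoing boundary and every element is a cycle. *)
Definition cycle_mod k : 'rV[R]_(r k) -> Prop :=
  match k return 'rV[R]_(r k) -> Prop with
  | 0 => fun _ => True
  | i.+1 => fun c => mx_mod (J i.+1) (c *m D i)
  end.

Lemma cycle_mod_kill k (c : 'rV[R]_(r k)) b (H : forall i, 'M[R]_(r i, r i.+1)) :
    (forall u : 'rV_(r 0%N), b *: u = u *m H 0%N *m D 0%N) ->
    (forall i (u : 'rV_(r i.+1)),
      b *: u = u *m H i.+1 *m D i.+1 + u *m D i *m H i) ->
  cycle_mod c -> mx_mod (J k) (b *: c - c *m H k *m D k).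
Proof.
move=> h0 hS; case: k c => [|k] c hc.
  by rewrite h0 subrr; apply: mx_mod0.
by rewrite hS addrAC subrr add0r; apply: mx_mod_mulr.
Qed.

(** Tor_k(R/I, R/J), with [J] generated by [k] terms of a regular sequence in
    [I], contains a copy of R/I: the class of [c] has annihilator [I].  Its image
    under a nullhomotopy of the next term is the next such class. *)
Lemma tor_cycle k : (k <= g)%N -> exists c : 'rV[R]_(r k), cycle_mod c /\
  forall a w, mx_mod (J k) (a *: c - w *m D k) -> a \in I.
Proof.
elim: k => [_|k IHk lt_k].
  have [c ec] := res_surj resD (quot_pi (ideal_submod I) 1).
  exists c; split=> // a w; rewrite take0 => /mx_mod_eq0/eqP.
  rewrite subr_eq0 => /eqP e1.
  have : e (a *: c) = 0 by rewrite e1; apply: (res_ed resD).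
  rewrite linearZ /= ec -linearZ -(linear0 (quot_pi (ideal_submod I))).
  by move=> /quot_piP; rewrite subr0 [_ *: _]mulr1.
have [c [cyc cI]] := IHk (ltnW lt_k).
have [H [h0 hS]] := matrix_nullhomotopy (xI (mem_nth 0 lt_k)).
have kill := cycle_mod_kill h0 hS cyc.
exists (c *m H k); rewrite /= (gen_ideal_takeS lt_k); split=> [|a w].
  apply: (adjoin_mx_mod (B := c)); rewrite -opprB; exact: mx_modN.
move=> /mx_mod_adjoin[B hB]; apply: (cI a B); apply: (mx_mod_regular lt_k).
have hBD := mx_mod_mulr (hJ k) (D k) hB.
move: hBD; rewrite !mulmxBl -[w *m _ *m _]mulmxA DD mulmx0 subr0 -!scalemxAl => hBD.
rewrite scalerBr scalerA mulrC -scalerA -(subrKA (a *: (c *m H k *m D k))).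
rewrite -scalerBr; apply: mx_modD => //; exact: mx_modZ.
Qed.

Section AtPrime.
Variables (q : prime_idealr R) (z : R).
Hypothesis qz : forall a, (a \in q) <-> gen_ideal x (a * z).

(** After inverting an element outside [q], the image of [D i] is a direct
    summand. *)
Definition splits_at i := exists (s : R) (H : 'M[R]_(r i, r i.+1)),
  s \notin q /\ D i *m H *m D i = s *: D i.

(** The Auslander-Buchsbaum mechanism.  As [z] embeds the residue field of [q]
    in R/(x) and Tor_(i+1)(R/I, R/(x)) vanishes, the map [D i] and the projection
    [P] onto a complement of the image of [D i.+1] have the same kernel modulo
    [q].  So [P] factors through [D i] modulo [q], and by Nakayama's determinant
    argument up to a multiplier outside [q]. *)
Lemma splits_at_pred i : (g <= i)%N -> splits_at i.+1 -> splits_at i.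
Proof.
move=> le_gi [s [H [qs hH]]].
set M := D i; set D' := D i.+1 in H hH.
pose P := s%:M - H *m D'.
have D'P : D' *m P = 0 by rewrite mulmxBr mul_mx_scalar mulmxA hH subrr.
have PM : P *m M = s *: M.
  by rewrite mulmxBl mul_scalar_mx -mulmxA DD mulmx0 subr0.
have PP : P *m P = s *: P.
  by rewrite {1}/P mulmxBl mul_scalar_mx -mulmxA D'P mulmx0 subr0.
clearbody P.
have hx : ideal_set (gen_ideal x) := ideal_gen_ideal x.
have hq := ideal_set_idealr q.
have ker_q (u : 'rV_(r i.+1)) :
    mx_mod [set` q] (u *m M) -> mx_mod [set` q] (u *m P).
  move=> uM; have [|w hw] := @tor_vanish g i (z *: u) (leqnn _) le_gi.
    move=> a b; rewrite take_size -scalemxAl mxE mulrC; exact/qz/uM.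
  move=> a b; apply/qz; rewrite mulrC.
  have := mx_mod_mulr (hJ g) P hw.
  rewrite mulmxBl -mulmxA D'P mulmx0 subr0 -scalemxAl take_size.
  by move=> /(_ a b); rewrite mxE.
have [t [N [qt hN]]] := prime_ginverse q M.
pose Y := M *m (N *m P) - t *: P.
have hY : mx_mod [set` q] Y.
  have -> : Y = (M *m N - t%:M) *m P.
    by rewrite /Y mulmxBl mul_scalar_mx mulmxA.
  move=> a b; have /(_ 0 b) : mx_mod [set` q] (row a (M *m N - t%:M) *m P).
    apply: ker_q; rewrite -row_mul => c d; rewrite mxE mulmxBl mul_scalar_mx.
    exact: hN.
  by rewrite -row_mul mxE.
(* [P *m W] factors through [M].  Modulo [q], [W] is a scalar outside [q], so the
   adjugate inverts it up to a multiplier outside [q]. *)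
pose W := (t * s * s)%:M + Y *m P.
have qW : \det W \notin q.
  apply: prime_det_scalar; last exact: mx_mod_mulr.
  by rewrite !prime_idealrM !negb_or qt qs.
have MN : M *m (N *m P) = t *: P + Y by rewrite /Y addrC subrK.
have WE : W = (t * s * s)%:M + Y *m P by [].
clearbody Y W; have sMN : s *: (M *m (N *m P)) *m P = P *m W.
  have -> : s *: (M *m (N *m P)) = P *m (t *: P + Y).
    by rewrite -MN [RHS]mulmxA PM scalemxAl.
  rewrite mulmxDr -scalemxAr PP mulmxDl -!scalemxAl PP WE mulmxDr mul_mx_scalar.
  by rewrite mulmxA !scalerA.
exists (\det W * s), (s *: (N *m P *m P *m \adj W)); split.
  by rewrite prime_idealrM negb_or qW.
have -> : M *m (s *: (N *m P *m P *m \adj W)) = (\det W) *: P.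
  rewrite -scalemxAr !mulmxA scalemxAl -[M *m N *m P]mulmxA scalemxAl sMN.
  by rewrite -mulmxA mul_mx_adj mul_mx_scalar.
by rewrite -scalemxAl PM scalerA.
Qed.

Lemma splits_at_grade n : (g <= n)%N -> splits_at n -> splits_at g.
Proof.
move=> le_gn; rewrite -(subnK le_gn); elim: (n - g)%N => // i IHi.
by rewrite addSn => /splits_at_pred h; apply/IHi/h/leq_addl.
Qed.

(** The copy of R/I in Tor_g(R/I, R/(x)) sits inside the cokernel of [D g] modulo
    (x), which is locally a summand of a free R/(x)-module; its coordinates there
    are elements of (x) : I, which therefore detect membership in [I]. *)
Lemma colon_colon_local a : splits_at g ->
    (forall y, (forall b, b \in I -> gen_ideal x (b * y)) -> gen_ideal x (a * y)) ->
  exists2 s, s \notin q & s * a \in I.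
Proof.
move=> [s [H [qs hH]]] ha; exists s => //.
have [c [cyc cI]] := tor_cycle (leqnn g).
pose P := s%:M - H *m D g.
have DP : D g *m P = 0 by rewrite mulmxBr mul_mx_scalar mulmxA hH subrr.
have cP j : gen_ideal x (a * (c *m P) 0 j).
  apply: ha => b Ib; have [h [h0 hS]] := matrix_nullhomotopy Ib.
  have := mx_mod_mulr (hJ g) P (cycle_mod_kill h0 hS cyc).
  rewrite mulmxBl -[_ *m D g *m P]mulmxA DP mulmx0 subr0 -scalemxAl take_size.
  by move=> /(_ 0 j); rewrite mxE.
apply: (cI _ (a *: (c *m H))) => i j; rewrite take_size.
have := cP j; rewrite (ord1 i); congr (gen_ideal _ _).
rewrite /P mulmxBr mul_mx_scalar mulmxA -!scalemxAl !mxE.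
by rewrite mulrBr mulrA (mulrC a s).
Qed.

End AtPrime.

(** Beyond the projective dimension a contracting homotopy [h] gives
    [u = d (h u) + h (d u)], and applying [d] leaves [d u = d (h (d u))]. *)
Lemma splits_at_finite_projdim q : finite_projdim (submod (ideal_submod I)) ->
  exists2 n, (g <= n)%N & splits_at q n.
Proof.
move=> /(finite_projdim_quot (@projective_regular R)) fpd.
have [n [h hh]] := finite_projdim_contraction resD fpd.
exists (maxn g n); first exact: leq_maxl.
set m := maxn g n; exists 1, (lin1_mx (h m)); split; first by rewrite idealr1.
rewrite scale1r; apply/row_matrixP => j; rewrite !row_mul mul_rV_lin1 /=.
have := hh m (row j 1%:M) (leq_maxr _ _) => /(congr1 (rmul (D m))).
by rewrite linearD (res_dd resD) add0r /= -row_mul mul1mx => /esym.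
Qed.

End RegularTensor.

(** * Divisorial ideals of unmixed ideals *)

Lemma ideal_sub_integral_closure (R : comNzRingType) (I : idealr R) a :
  a \in I -> integral_closure I a.
Proof.
move=> Ia; exists 1%N, (fun=> - a); split=> // [i|].
  case: i => [//|[_|//]].
  exists 1%N, (fun=> - a), (fun=> 1); split=> [i _|].
    by split; first exact: rpredNr.
  by rewrite big_ord1 mulr1.
by rewrite big_nat1 subnn expr1 expr0 mulr1 subrr.
Qed.

(** If [a] in D(I) were outside [I], a multiple [b * a] would have a prime
    annihilator [q] modulo [I]; the local statement at [q] yields [s] outside [q]
    killing it. *)
Lemma divisorial_sub_unmixed (R : comNzRingType) (I : idealr R) a :
    noetherian R -> local_ring R -> krull_dim R = 3%N -> S2 R -> unmixed I ->
    finite_projdim (submod (ideal_submod I)) ->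
  divisorial I a -> a \in I.
Proof.
move=> noethR localR dimR S2R unmixI fpdI Da; apply: contraT => /negP nIa.
have chain3 n (C : nat -> prime_idealr R) : prime_chain n C -> (n <= 3)%N.
  by move=> hC; apply: (supremum_nat_bound dimR); exists C.
have [x [xreg xgrade xI xmax]] := grade_seq chain3 noethR I.
have [q [b hq]] := ass_prime_above noethR (ideal_set_idealr I) nIa.
have Iq : {subset I <= q}.
  by move=> c Ic; apply/hq; rewrite mulrC; apply: idealMr.
have htq : height q = ideal_height I.
  by apply: unmixI; apply/ass_prime_quotP; exists (b * a).
have [z qz] := unmixed_socle noethR localR dimR S2R xreg xI xmax Iq htq.
have [r [D [e resD]]] := finite_free_resolution noethR I.
have [n le_gn /(splits_at_grade xreg resD qz le_gn) hsplit] :=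
  splits_at_finite_projdim x resD q fpdI.
have [|s qs] := colon_colon_local xreg xI resD (a := b * a) hsplit.
  move=> y Iy; rewrite -mulrA; apply: ideal_setM; first exact: ideal_gen_ideal.
  exact: (divisorial_colon xreg xI xgrade Da).
by move/hq; rewrite (negPf qs).
Qed.

Local Close Scope ring_scope.
Local Close Scope classical_set_scope.

Theorem proposition4p7 (R : comNzRingType) (I : idealr R)
    (hnoeth : noetherian R) (hlocal : local_ring R)
    (hdim : krull_dim R = 3) (hqn : quasi_normal R)
    (hunmixed : unmixed I)
    (hpd : finite_projdim (submod (ideal_submod I))) :
  (divisorial I `<=` integral_closure I)%classic.
Proof.
move=> a Da; apply: ideal_sub_integral_closure.
exact: (divisorial_sub_unmixed hnoeth hlocal hdim hqn.2 hunmixed hpd Da).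
Qed.
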